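(* Let $X(\Sigma)$ be the smooth compact toric manifold constructed from a Delzant polytope $\Delta\subset\mathfrak t^*$ with dual fan $\Sigma$, with Poisson structure $\Pi_\Sigma$. Let $V$ be a vertex of $\Delta$, with associated $n\times(d-n)$ integral matrix $A_V$ and associated coordinate chart $w_V:zN_{\mathbb C}\mapsto(w_1,\dots,w_n)$. In terms of these coordinates the Poisson structure $\Pi_\Sigma$ has the form $$\Pi_\Sigma=\sum_{p,q=1}^n iB_{pq}\,\bar w_p w_q\,\partial_{\bar w_p}\wedge\partial_{w_q},$$ where $B_{pq}$ are the components of the symmetric positive definite integral matrix $B_V=1+A_V(A_V)^t$. In particular, $\Pi_\Sigma$ is a homogeneous quadratic Poisson structure in each vertex chart.
   Context: Let $T$ be a compact torus of dimension $n\ge 1$ with Lie algebra $\mathfrak t$ and complexification $T_{\mathbb C}$. Let $\Lambda\subset\mathfrak t$ be the integral lattice (kernel of $\exp:\mathfrak t\to T$) and $\Lambda^*\subset\mathfrak t^*$ the dual lattice. A convex polytope $\Delta\subset\mathfrak t^*$ is Delzant if for each vertex $\nu$ the edges emanating from $\nu$ lie in rays $\{\nu+t\eta_i: t\ge0\}$, $i=1,\dots,n$, where $\eta_1,\dots,\eta_n$ is a $\mathbb Z$-basis of $\Lambda^*$. Enumerate the facets of $\Delta$ as $1,\dots,d$ and let $u_\ell\in\Lambda$ be the primitive inward normal to the $\ell$-th facet. Each (nonempty) face $F$ of $\Delta$ is labeled by the set of indices of the facets containing it ($\Delta$ itself is labeled by $\emptyset$). The dual fan $\Sigma$ consists of the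 cones generated by $\{u_s:s\in S\}$ with $S$ labeling a face. The torus $(\mathbb C^* )^d$ acts on $\mathbb C^d$ coordinatewise. Let $N_{\mathbb C}=\{\zeta\in(\mathbb C^* )^d:\prod_\ell \zeta_\ell^{\langle m,u_\ell\rangle}=1\ \forall m\in\Lambda^*\}$. Let $\mathcal U_\Sigma\subset\mathbb C^d$ be the open set of $z$ such that $\{\ell:z_\ell=0\}$ labels a face of $\Delta$. $N_{\mathbb C}$ acts freely on $\mathcal U_\Sigma$, and $X(\Sigma)=\mathcal U_\Sigma/N_{\mathbb C}$ is a compact complex manifold of complex dimension $n$ with an action of $T_{\mathbb C}\cong(\mathbb C^* )^d/N_{\mathbb C}$. The bivector field $\Pi=\sum_{\ell=1}^d i|z_\ell|^2\partial_{\bar z_\ell}\wedge\partial_{z_\ell}$ (with $\partial_z=\frac12(\partial_x-i\partial_y)$, $\partial_{\bar z}=\frac12(\partial_x+i\partial_y)$) is a real Poisson structure on $\mathbb C^d$ invariant under $(\mathbb C^* )^d$; $\Pi_\Sigma$ is the unique Poisson structure on $X(\Sigma)$ for which the quotient map $(\mathcal U_\Sigma,\Pi)\to X(\Sigma)$ is a Poisson map. Vertex coordinates: for a vertex $V$ labeled by $S_V=\{s_1<\dots<s_n\}$, with complement $\{s_{n+1}<\dots<s_d\}$, the vectors $u_{s_1},\dots,u_{s_n}$ form a basis of $\Lambda$; let $A_V=(a_{k\ell})$ be the unique $n\times(d-n)$ integer matrix with $u_{s_{n+\ell}}+\sum_{k=1}^n a_{k\ell}u_{s_k}=0$ for all $\ell=1,\dots,d-n$.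 The chart $w_V$ is defined on the open set $\mathcal U_V/N_{\mathbb C}\subset X(\Sigma)$, where $\mathcal U_V=\{z\in\mathbb C^d: z_s\neq0\ \forall s\notin S_V\}$, with image $\mathbb C^n$, by $w_k=z_{s_k}\prod_{m=1}^{d-n}z_{s_{n+m}}^{-a_{km}}$, $k=1,\dots,n$. *)

(* Defs.v *)
From HB Require Import structures.
From mathcomp Require Import all_boot all_order all_algebra.
From mathcomp Require Import complex.
From mathcomp Require Import all_classical all_reals all_analysis.

Set Implicit Arguments.
Unset Strict Implicit.
Unset Printing Implicit Defensive.

Import Order.TTheory GRing.Theory Num.Theory.
Import numFieldNormedType.Exports.

Local Open Scope classical_set_scope.
Local Open Scope ring_scope.

(** * Lattices and Delzant polytopes *)

Section Polytope.
Variables (R : realType) (t : vectType R).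

Definition dual_space := 'Hom(t, R^o).

Definition pairing (m : dual_space) (v : t) : R := m v.

Definition is_lattice (n : nat) (L : set t) : Prop :=
  exists2 e : n.-tuple t, basis_of fullv e &
    L = [set v | exists c : 'I_n -> int, v = \sum_(i < n) tnth e i *~ c i].

Definition dual_lattice (L : set t) : set dual_space :=
  [set m | forall v, L v -> pairing m v \is a Num.int].

Definition is_Zbasis (W : zmodType) (n : nat) (L : set W) (e : 'I_n -> W) : Prop :=
  (forall i, L (e i)) /\
  (forall m, L m -> exists! c : 'rV[int]_n, m = \sum_(i < n) e i *~ c 0 i).

Definition is_primitive (L : set t) (v : t) : Prop :=
  L v /\ forall (w : t) (k : nat), L w -> v = w *+ k -> k = 1%N.

Definition is_polytope (D : set dual_space) : Prop :=
  exists (k : nat) (p : 'I_k -> dual_space),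
    D = [set x | exists c : 'I_k -> R,
           [/\ forall i, 0 <= c i, \sum_i c i = 1 & x = \sum_i c i *: p i]].

(* Nonempty faces; the choice v = 0 gives D itself. *)
Definition is_face (D F : set dual_space) : Prop :=
  F !=set0 /\
  exists v : t,
    F = [set x | D x /\ forall y, D y -> pairing x v <= pairing y v].

(* The affine hull of F is a translate of the subspace U. *)
Definition has_dim (F : set dual_space) (k : nat) : Prop :=
  exists U : {vspace dual_space},
    [/\ \dim U = k,
        forall x y, F x -> F y -> x - y \in U &
        forall W : {vspace dual_space},
          (forall x y, F x -> F y -> x - y \in W) -> (U <= W)%VS].

Definition is_vertex (D : set dual_space) (x : dual_space) : Prop := is_face D [set x].

Definition is_edge (D E : set dual_space) : Prop := is_face D E /\ has_dim E 1.

Definition is_facet (n : nat) (D F : set dual_space) : Prop :=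
  is_face D F /\ has_dim F n.-1.

Definition ray (x eta : dual_space) : set dual_space :=
  [set y | exists2 a : R, 0 <= a & y = x + a *: eta].

Definition is_delzant (n : nat) (L : set t) (D : set dual_space) : Prop :=
  is_polytope D /\
  forall nu, is_vertex D nu ->
    exists eta : 'I_n -> dual_space,
      [/\ is_Zbasis (dual_lattice L) eta,
          forall i, exists E, [/\ is_edge D E, E nu & E `<=` ray nu (eta i)] &
          forall E, is_edge D E -> E nu -> exists i, E `<=` ray nu (eta i)].

Definition facet_enumeration (n d : nat) (D : set dual_space)
    (Fac : 'I_d -> set dual_space) : Prop :=
  injective Fac /\ range Fac = [set F | is_facet n D F].

Definition primitive_inward_normal (L : set t) (D F : set dual_space) (v : t) : Prop :=
  [/\ is_primitive L v,
      forall x y, F x -> F y -> pairing x v = pairing y v &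
      forall x y, F x -> D y -> pairing x v <= pairing y v].

Definition labels_face (d : nat) (D : set dual_space) (Fac : 'I_d -> set dual_space)
    (S : set 'I_d) : Prop :=
  exists2 F, is_face D F & S = [set l | F `<=` Fac l].

Definition increasing_enumeration (k d : nat) (s : 'I_k -> 'I_d) (S : set 'I_d) :
    Prop :=
  (forall i j : 'I_k, (i < j)%N -> (s i < s j)%N) /\ range s = S.

End Polytope.

(** * Smooth functions and Wirtinger derivatives on C^d *)

Section Calculus.
Variable R : realType.
Local Notation C := R[i].

Definition rvec (d : nat) (z : 'rV[C]_d) : 'rV[R]_(d + d) :=
  row_mx (map_mx (@complex.Re R) z) (map_mx (@complex.Im R) z).

Definition cvec (d : nat) (x : 'rV[R]_(d + d)) : 'rV[C]_d :=
  \row_j Complex (lsubmx x 0 j) (rsubmx x 0 j).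

Lemma rvecK (d : nat) : cancel (@rvec d) (@cvec d).
Proof.
move=> z; apply/rowP => j; rewrite mxE row_mxKl row_mxKr !mxE.
by case: (z 0 j).
Qed.

Lemma cvecK (d : nat) : cancel (@cvec d) (@rvec d).
Proof.
move=> x; rewrite -[RHS]hsubmxK /rvec.
by congr row_mx; apply/rowP => j; rewrite !mxE.
Qed.

Definition openC (d : nat) (O : set 'rV[C]_d) : Prop := open (@cvec d @^-1` O).

(* C^oo on an open set: every iterated directional derivative is Frechet
   differentiable (over the reals) at every point of O. *)
Definition smooth_on (d : nat) (O : set 'rV[C]_d) (f : 'rV[C]_d -> R) : Prop :=
  forall (vs : seq 'rV[R]_(d + d)) (z : 'rV[C]_d), O z ->
    differentiable
      (foldr (fun v (g : 'rV[R]_(d + d) -> R) => 'D_v g) (f \o @cvec d) vs)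
      (rvec z).

Definition partial_x (d : nat) (k : 'I_d) (f : 'rV[C]_d -> R) (z : 'rV[C]_d) : R :=
  'D_(delta_mx 0 (lshift d k)) (f \o @cvec d) (rvec z).

Definition partial_y (d : nat) (k : 'I_d) (f : 'rV[C]_d -> R) (z : 'rV[C]_d) : R :=
  'D_(delta_mx 0 (rshift d k)) (f \o @cvec d) (rvec z).

Definition partial (d : nat) (k : 'I_d) (f : 'rV[C]_d -> R) (z : 'rV[C]_d) : C :=
  2^-1 * ((partial_x k f z)%:C%C - ('i)%C * (partial_y k f z)%:C%C).

Definition partial_bar (d : nat) (k : 'I_d) (f : 'rV[C]_d -> R) (z : 'rV[C]_d) : C :=
  2^-1 * ((partial_x k f z)%:C%C + ('i)%C * (partial_y k f z)%:C%C).

(* The value at z of (Y1 /\ Y2)(df, dg), for complex vector fields Y1, Y2. *)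
Definition wedge (d : nat) (Y1 Y2 : ('rV[C]_d -> R) -> 'rV[C]_d -> C)
    (f g : 'rV[C]_d -> R) (z : 'rV[C]_d) : C :=
  Y1 f z * Y2 g z - Y2 f z * Y1 g z.

Definition Pi_std (d : nat) (f g : 'rV[C]_d -> R) (z : 'rV[C]_d) : C :=
  \sum_(l < d) ('i)%C * `|z 0 l| ^+ 2 * wedge (partial_bar l) (partial l) f g z.

End Calculus.

(** * Poisson structures *)

(* A Poisson structure is encoded by its bracket on the sheaf of smooth real
   functions of a space whose points form a type M.  [op O] says that O is an
   open set of the space and [sm O f] that f is smooth on O.  Local functions
   are total functions whose values off the open set do not matter. *)
Record poisson_structure (R : realType) (M : Type) (op : set M -> Prop)
    (sm : set M -> (M -> R) -> Prop) (br : (M -> R) -> (M -> R) -> M -> R) : Prop :=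
  PoissonStructure {
    poisson_smooth : forall O f g, op O -> sm O f -> sm O g -> sm O (br f g);
    poisson_local : forall O f f' g g', op O ->
      sm O f -> sm O f' -> sm O g -> sm O g' ->
      (forall x, O x -> f x = f' x) -> (forall x, O x -> g x = g' x) ->
      forall x, O x -> br f g x = br f' g' x;
    poisson_skew : forall O f g, op O -> sm O f -> sm O g ->
      forall x, O x -> br f g x = - br g f x;
    poisson_linear : forall O (a : R) f g h, op O -> sm O f -> sm O g -> sm O h ->
      forall x, O x -> br (fun y => a * f y + g y) h x = a * br f h x + br g h x;
    poisson_leibniz : forall O f g h, op O -> sm O f -> sm O g -> sm O h ->
      forall x, O x -> br (fun y => f y * g y) h x = f x * br g h x + br f h x * g x;
    poisson_jacobi : forall O f g h, op O -> sm O f -> sm O g -> sm O h ->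
      forall x, O x ->
        br f (br g h) x + br g (br h f) x + br h (br f g) x = 0
  }.

(** * The toric manifold *)

Section Toric.
Variables (R : realType) (t : vectType R) (n d : nat).
Variables (L : set t) (D : set (dual_space t)) (Fac : 'I_d -> set (dual_space t)).
Variable u : 'I_d -> t.
Local Notation C := R[i].

(* For m in the dual lattice and u l in L the pairing is an integer, and
   Num.floor only retypes it. *)
Definition NC : set 'rV[C]_d :=
  [set zeta : 'rV[C]_d | (forall l, zeta 0 l != 0) /\
     forall m, dual_lattice L m ->
       \prod_(l < d) zeta 0 l ^ Num.floor (pairing m (u l)) = 1].

Definition NC_orbit (z : 'rV[C]_d) : set 'rV[C]_d :=
  [set z' : 'rV[C]_d | exists2 zeta, NC zeta & z' = \row_l (zeta 0 l * z 0 l)].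

Definition U_Sigma : set 'rV[C]_d :=
  [set z : 'rV[C]_d | labels_face D Fac [set l | z 0 l = 0]].

Definition X_Sigma : set (set 'rV[C]_d) := NC_orbit @` U_Sigma.

(* Quotient topology and quotient smooth structure. *)
Definition open_X (O : set (set 'rV[C]_d)) : Prop :=
  O `<=` X_Sigma /\ openC (NC_orbit @^-1` O).

Definition smooth_X (O : set (set 'rV[C]_d)) (f : set 'rV[C]_d -> R) : Prop :=
  smooth_on (NC_orbit @^-1` O) (f \o NC_orbit).

Definition bracket_X :=
  (set 'rV[C]_d -> R) -> (set 'rV[C]_d -> R) -> set 'rV[C]_d -> R.

Definition quotient_map_is_poisson (br : bracket_X) : Prop :=
  forall O f g, open_X O -> smooth_X O f -> smooth_X O g ->
    forall z, O (NC_orbit z) ->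
      (br f g (NC_orbit z))%:C%C = Pi_std (f \o NC_orbit) (g \o NC_orbit) z.

Definition is_Pi_Sigma (br : bracket_X) : Prop :=
  poisson_structure open_X smooth_X br /\ quotient_map_is_poisson br.

(** * Vertex charts *)

Definition vertex_label (V : dual_space t) : set 'I_d := [set l | Fac l V].

Definition U_vertex (V : dual_space t) : set 'rV[C]_d :=
  [set z : 'rV[C]_d | forall l, ~ vertex_label V l -> z 0 l != 0].

Definition chart_domain (V : dual_space t) : set (set 'rV[C]_d) :=
  NC_orbit @` U_vertex V.

Variables (s : 'I_n -> 'I_d) (s' : 'I_(d - n) -> 'I_d) (A : 'M[int]_(n, d - n)).

Definition is_vertex_matrix : Prop :=
  forall l : 'I_(d - n), u (s' l) + \sum_(k < n) u (s k) *~ A k l = 0.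

Definition wcoord (z : 'rV[C]_d) : 'rV[C]_n :=
  \row_k (z 0 (s k) * \prod_(m < d - n) z 0 (s' m) ^ (- A k m)).

(* wcoord is constant on the orbits in the chart domain, so any representative
   of the orbit x may be used. *)
Definition chart (x : set 'rV[C]_d) : 'rV[C]_n := wcoord (xget 0 x).

Definition chart_inv (V : dual_space t) : 'rV[C]_n -> set 'rV[C]_d :=
  'pinv_(fun=> set0) (chart_domain V) chart.

Definition BV : 'M[int]_n := 1%:M + A *m A^T.

Definition Pi_chart (f g : 'rV[C]_n -> R) (w : 'rV[C]_n) : C :=
  \sum_(p < n) \sum_(q < n)
    ('i)%C * (BV p q)%:~R * (w 0 p)^*%C * w 0 q *
      wedge (partial_bar p) (partial q) f g w.

Definition has_chart_form (V : dual_space t) (br : bracket_X) : Prop :=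
  forall O f g, open_X O -> smooth_X O f -> smooth_X O g ->
    forall x, O x -> chart_domain V x ->
      (br f g x)%:C%C = Pi_chart (f \o chart_inv V) (g \o chart_inv V) (chart x).

(* The components of the bivector field in the linear real coordinates
   (Re w, Im w) of the chart are quadratic forms in these coordinates. *)
Definition homogeneous_quadratic (V : dual_space t) (br : bracket_X) : Prop :=
  forall j k : 'I_(n + n), exists Q : 'M[R]_(n + n),
    forall x, chart_domain V x ->
      br (fun y => rvec (chart y) 0 j) (fun y => rvec (chart y) 0 k) x =
      (rvec (chart x) *m Q *m (rvec (chart x))^T) 0 0.

End Toric.

Definition positive_definite (R : realType) (n : nat) (B : 'M[int]_n) : Prop :=
  forall v : 'rV[R]_n, v != 0 -> 0 < (v *m map_mx intr B *m v^T) 0 0.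

(* Main.v *)
Require Import Defs.
From HB Require Import structures.
From mathcomp Require Import all_boot all_order all_algebra.
From mathcomp Require Import complex.
From mathcomp Require Import all_classical all_reals all_analysis.
From mathcomp Require Import ring lra.

Import Order.TTheory GRing.Theory Num.Theory.
Import numFieldNormedType.Exports.
Local Open Scope classical_set_scope.
Local Open Scope ring_scope.

(** Write [c k l] for the coordinates of the normal [u l] in the basis
    [u (s k)], so that the chart is the monomial map [w_k = prod_l z_l ^ c k l].
    With E_l and T_l the radial and the rotational vector field of the l-th
    coordinate, Pi = 1/2 sum_l E_l /\ T_l.  The monomial map pushes E_l to
    sum_k c k l E_k and T_l to sum_k c k l T_k, hence Pi to
    1/2 sum_pq (c c^T)_pq E_p /\ T_q, and c c^T = 1 + A A^T.

    The geometric input is that the normals of the facets through V are dual to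
    the Delzant basis eta, which makes the chart constant on orbits, and that every
    set of such facets labels a face, which puts the chart domain inside X.  Both
    follow once the polytope is known to lie in the cone V + cone(eta).  If it did
    not, some functional nonnegative on eta would be smaller than at V somewhere on
    the polytope, and a parametric simplex argument would produce an edge at V along
    which it decreases. *)

(** * Convex geometry at a Delzant vertex *)

Section Geometry.
Set Implicit Arguments.
Unset Strict Implicit.
Variables (R : realType) (t : vectType R).
Implicit Types (x y : dual_space t) (v w f g : t).

Lemma pairingDl x y v : pairing (x + y) v = pairing x v + pairing y v.
Proof. exact: add_lfunE. Qed.
Lemma pairingBl x y v : pairing (x - y) v = pairing x v - pairing y v.
Proof. by rewrite /pairing add_lfunE opp_lfunE. Qed.
Lemma pairingZl (a : R) x v : pairing (a *: x) v = a * pairing x v.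
Proof. exact: scale_lfunE. Qed.
Lemma pairing_suml (I : finType) (F : I -> dual_space t) v :
  pairing (\sum_i F i) v = \sum_i pairing (F i) v.
Proof. exact: sum_lfunE. Qed.
Lemma pairingMzl x v (a : int) : pairing (x *~ a) v = a%:~R * pairing x v.
Proof. by rewrite -scaler_int pairingZl. Qed.
Lemma pairingDr x v w : pairing x (v + w) = pairing x v + pairing x w.
Proof. exact: linearD. Qed.
Lemma pairingZr (a : R) x v : pairing x (a *: v) = a * pairing x v.
Proof. exact: linearZ. Qed.
Lemma pairingMzr x v (a : int) : pairing x (v *~ a) = a%:~R * pairing x v.
Proof. by rewrite -scaler_int pairingZr. Qed.
Lemma pairing_sumr (I : finType) (P : pred I) (F : I -> t) x :
  pairing x (\sum_(i | P i) F i) = \sum_(i | P i) pairing x (F i).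
Proof. exact: linear_sum. Qed.

(** The number [1 + S] exceeds every ratio [(|b i| + 1) / a i] with [P i], so its inverse [e]
    satisfies [e * |b i| < a i] for all these [i] at once. *)
Lemma small_perturbation (T : finType) (P : pred T) (a b : T -> R) :
  (forall i, P i -> 0 < a i) ->
  exists2 e : R, 0 < e & forall i, P i -> 0 < a i + e * b i.
Proof.
move=> a0; pose S := \sum_(i | P i) (`|b i| + 1) / a i.
have S0 i : P i -> 0 < (`|b i| + 1) / a i.
  by move=> Pi; rewrite divr_gt0 ?a0// ltr_wpDl.
have S1 : 0 < 1 + S.
  by rewrite ltr_pwDl// sumr_ge0// => i /S0/ltW.
exists (1 + S)^-1 => [|i Pi]; first by rewrite invr_gt0.
have : (`|b i| + 1) / a i < 1 + S.
  rewrite /S (bigD1 i)//= ltr_pwDl// lerDl sumr_ge0// => j /andP[/S0/ltW//].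
rewrite ltr_pdivrMr ?a0// => lt1.
have : - `|b i| <= b i by rewrite lerNl ler_normr lexx orbT.
rewrite -(pmulr_rgt0 _ S1) mulrDr mulVKf ?gt_eqF//; lra.
Qed.

(* The face exposed by g is shrunk, by perturbing g in a generic direction
   v' + l f with l extremal, until it spans a single line. *)
Lemma exposed_ray (k : nat) (q : 'I_k -> dual_space t) v f :
  (forall i, q i != 0 -> 0 < pairing (q i) v) ->
  (exists i, pairing (q i) f < 0) ->
  exists g i0, [/\ forall i, 0 <= pairing (q i) g, pairing (q i0) g = 0,
    pairing (q i0) f < 0 &
    forall j, pairing (q j) g = 0 -> q j \in <[q i0]>%VS].
Proof.
move=> v0 [i0 fi0].
pose Z g := [set i | pairing (q i) g == 0]%SET.
(* Induction on a strict bound [m] for the number of generators killed by [g]; the start [g = 0]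
   kills all of them. *)
suff: forall m g i0, (#|Z g| < m)%N -> (forall i, 0 <= pairing (q i) g) ->
    pairing (q i0) g = 0 -> pairing (q i0) f < 0 ->
  exists g i0, [/\ forall i, 0 <= pairing (q i) g, pairing (q i0) g = 0,
    pairing (q i0) f < 0 &
    forall j, pairing (q j) g = 0 -> q j \in <[q i0]>%VS].
  have p0 i : pairing (q i) 0 = 0 by rewrite /pairing linear0.
  by move=> /(_ _ 0 i0 (ltnSn _)); apply=> // i; rewrite p0.
elim=> [//|m IH] {fi0}g {}i0 ltZ g0 gi0 fi0.
have [allj|] := pselect (forall j, pairing (q j) g = 0 -> q j \in <[q i0]>%VS).
  by exists g, i0.
move/existsNP => [j /not_implyP[gj /negP qj]].
(* The combination of [q i0] and [q j] killed by [f]: adding multiples of [f] to a functional leaves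
   its value on [r] unchanged. It is nonzero because [q j] is off the line of [q i0]. *)
pose r := pairing (q j) f *: q i0 - pairing (q i0) f *: q j.
have r0 : r != 0.
  apply: contra qj; rewrite subr_eq0 => /eqP qE.
  apply/vlineP; exists ((pairing (q i0) f)^-1 * pairing (q j) f).
  by rewrite -scalerA qE scalerA mulVf ?scale1r// lt_eqF.
have [h rh] : exists h, pairing r h != 0.
  apply: contrapT => /forallNP rh; move/eqP: r0; apply.
  by apply/lfunP => h; rewrite zero_lfunE; have /negP := rh h; rewrite negbK => /eqP.
(* If [v] happens to kill [r], a small perturbation makes it generic while keeping it positive on
   the nonzero generators. *)
have [v' v'0 rv'] : exists2 v', forall i, q i != 0 -> 0 < pairing (q i) v' &
    pairing r v' != 0.
  have [rv|rv] := eqVneq (pairing r v) 0; last first.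
    exists v; [exact: v0|exact: rv].
  have [e e0 He] := @small_perturbation 'I_k (fun i => q i != 0)
    (fun i => pairing (q i) v) (fun i => pairing (q i) h) v0.
  exists (v + e *: h) => [i qi|]; first by rewrite pairingDr pairingZr He.
  by rewrite pairingDr rv add0r pairingZr mulf_neq0// gt_eqF.
have v'ge i : 0 <= pairing (q i) v'.
  have [->|/v'0/ltW//] := eqVneq (q i) 0.
  by rewrite /pairing zero_lfunE.
(* Ratio test of the simplex method: among the generators killed by [g] on which [f] is negative,
   [i1] is the first to reach zero when multiples of [f] are added to [v']. *)
pose P := [pred i | (pairing (q i) g == 0) && (pairing (q i) f < 0)].
have Pi0 : P i0 by rewrite /= gi0 eqxx.
pose F i := pairing (q i) v' / - pairing (q i) f.
have [i1 /andP[/eqP gi1 fi1] mini] := @arg_minP _ _ _ i0 P F Pi0.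
pose g' := v' + F i1 *: f.
have F0 : 0 <= F i1 by rewrite divr_ge0// oppr_ge0 ltW.
have g'E i : pairing (q i) g' = pairing (q i) v' + F i1 * pairing (q i) f.
  by rewrite pairingDr pairingZr.
have g'0 i : pairing (q i) g = 0 -> 0 <= pairing (q i) g'.
  move=> gi; rewrite g'E; have [fi|fi] := ltP (pairing (q i) f) 0; last first.
    by rewrite addr_ge0// mulr_ge0.
  have : F i1 <= F i by apply: mini; rewrite /= gi eqxx.
  by rewrite {2}/F ler_pdivlMr ?oppr_gt0// mulrN -subr_ge0 opprK.
have g'i1 : pairing (q i1) g' = 0.
  by rewrite g'E /F invrN mulrN mulNr mulfVK ?subrr// lt_eqF.
(* A small multiple of [g'] keeps [g] positive where it already was, so [g2] can vanish only where
   [g] does. *)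
have [e e0 He] := @small_perturbation 'I_k (fun i => pairing (q i) g != 0)
    (fun i => pairing (q i) g) (fun i => pairing (q i) g')
    (fun i gi => etrans (lt0r _) (introT andP (conj gi (g0 i)))).
pose g2 := g + e *: g'.
have g2E i : pairing (q i) g2 = pairing (q i) g + e * pairing (q i) g'.
  by rewrite pairingDr pairingZr.
have g2Z i : pairing (q i) g2 = 0 -> pairing (q i) g = 0.
  move=> gi; apply/eqP; apply: contraT => /He.
  by rewrite -g2E gi ltxx.
apply: (IH g2 i1) => //.
- apply: leq_trans (_ : #|Z g| <= m)%N; last by [].
  apply: proper_card; rewrite properE; apply/andP; split.
    by apply/fintype.subsetP => i; rewrite !inE => /eqP/g2Z/eqP.
  (* If no generator left the zero set, [g'] would kill [q i0] and [q j], hence [r]; but on [r] it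
     agrees with [v'], which is nonzero there. *)
  apply/negP => /fintype.subsetP sub.
  have zero i : pairing (q i) g = 0 -> pairing (q i) g' = 0.
    move=> gi; have := sub i; rewrite !inE gi eqxx => /(_ isT).
    by rewrite g2E gi add0r mulf_eq0 gt_eqF//= => /eqP.
  move/eqP: rv'; apply.
  have : pairing r g' = 0.
    by rewrite pairingBl !pairingZl !zero// !mulr0 subrr.
  rewrite /g' pairingDr pairingZr [X in _ + _ * X](_ : _ = 0) ?mulr0 ?addr0//.
  by rewrite pairingBl !pairingZl mulrC subrr.
- move=> i; rewrite g2E; have [gi|gi] := eqVneq (pairing (q i) g) 0.
    by rewrite gi add0r mulr_ge0 ?g'0// ltW.
  by apply/ltW/He.
- by rewrite g2E gi1 g'i1 mulr0 addr0.
Qed.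

(** Seen from [V], the polytope is generated by the differences [q i = p i - V], and [x] forces [f]
    to be negative on one of them. The functional given by [exposed_ray] then exposes a face through
    [V] whose directions span one line, which is the edge sought. *)
Lemma polytope_edge (D : set (dual_space t)) V f x :
  is_polytope D -> is_vertex D V -> D x -> pairing x f < pairing V f ->
  exists E y, [/\ is_edge D E, E V, E y & pairing y f < pairing V f].
Proof.
move=> [k [p DE]] [_ [v VE]] Dx xf.
have Dp i : D (p i).
  rewrite DE; exists (fun j => (j == i)%:R); split.
  - by move=> j; rewrite ler0n.
  - by rewrite (bigD1 i)//= eqxx big1 ?addr0// => j /negbTE->.
  - rewrite (bigD1 i)//= eqxx scale1r big1 ?addr0// => j /negbTE->.
    by rewrite scale0r.
have [DV Vmin] : D V /\ forall y, D y -> pairing V v <= pairing y v.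
  by have : [set V] V by []; rewrite VE.
(* On [D] the functional [v] is minimal at [V] only, hence strictly positive on every nonzero
   [q i]. *)
have Vuniq y : D y -> pairing y v <= pairing V v -> y = V.
  move=> Dy yV; have : [set V] y; last by [].
  rewrite VE; split=> // z Dz; exact: le_trans yV (Vmin _ Dz).
pose q i := p i - V.
have qE (c : 'I_k -> R) g : \sum_i c i = 1 ->
    pairing (\sum_i c i *: p i) g - pairing V g = \sum_i c i * pairing (q i) g.
  move=> c1; rewrite pairing_suml -[pairing V g]mul1r -c1 mulr_suml -sumrB.
  by apply: eq_bigr => i _; rewrite pairingZl pairingBl mulrBr.
have [g [i0 [g0 gi0 fi0 gZ]]] : exists g i0, [/\ forall i, 0 <= pairing (q i) g,
    pairing (q i0) g = 0, pairing (q i0) f < 0 &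
    forall j, pairing (q j) g = 0 -> q j \in <[q i0]>%VS].
  apply: (@exposed_ray k q v f) => [i|].
    move=> qi; rewrite pairingBl subr_gt0 ltNge; apply: contra qi => pi.
    by rewrite subr_eq0 (Vuniq _ (Dp i) pi).
  apply: contrapT => /forallNP qf.
  move: Dx xf; rewrite DE => -[c [c0 c1 ->]]; rewrite -subr_lt0 qE//.
  rewrite ltNge sumr_ge0// => i _; rewrite mulr_ge0// leNgt.
  by apply/negP/qf.
have q0 : q i0 != 0.
  by apply: contraTneq fi0 => ->; rewrite /pairing zero_lfunE ltxx.
pose E := [set y | D y /\ forall z, D z -> pairing y g <= pairing z g].
have gV z : D z -> pairing V g <= pairing z g.
  rewrite DE => -[c [c0 c1 ->]]; rewrite -subr_ge0 qE//.
  by rewrite sumr_ge0// => i _; rewrite mulr_ge0.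
have EV : E V by split.
have Ep : E (p i0).
  split=> // z Dz; apply: le_trans (gV z Dz).
  by rewrite -subr_le0 -pairingBl -/(q i0) gi0.
(* For a point of [E] the nonnegative terms [c i * pairing (q i) g] sum to zero, so only generators
   on the line of [q i0] contribute. *)
have EU y : E y -> y - V \in <[q i0]>%VS.
  move=> [Dy /(_ V DV)]; move: Dy; rewrite DE => -[c [c0 c1 ->]].
  rewrite -subr_le0 qE// => le0.
  have /psumr_eq0P z : \sum_i c i * pairing (q i) g = 0.
    by apply/le_anti; rewrite le0 sumr_ge0// => i _; rewrite mulr_ge0.
  rewrite -[V]scale1r -c1 scaler_suml -sumrB rpred_sum// => i _.
  rewrite -scalerBr; have [->|ci] := eqVneq (c i) 0; first by rewrite scale0r mem0v.
  apply/rpredZ/gZ/(mulfI ci).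
  by rewrite mulr0 z// => j _; rewrite mulr_ge0.
exists E, (p i0); split=> //; last by rewrite -subr_lt0 -pairingBl.
split; first by split; [exists V | exists g].
exists <[q i0]>%VS; split.
- by rewrite dim_vline q0.
- move=> y z /EU yV /EU zV; have -> : y - z = (y - V) - (z - V).
    by rewrite opprB addrA subrK.
  exact: rpredB.
- by move=> W HW; rewrite -memvE; apply: HW.
Qed.

(** A point violating the bound would give an edge at [V] along which [f] decreases, while that edge
    lies in a ray in some direction [eta i], where [f] is nonnegative. *)
Lemma delzant_vertex_cone (n : nat) (D : set (dual_space t)) V
    (eta : 'I_n -> dual_space t) f :
  is_polytope D -> is_vertex D V ->
  (forall E, is_edge D E -> E V -> exists i, E `<=` ray V (eta i)) ->
  (forall i, 0 <= pairing (eta i) f) ->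
  forall x, D x -> pairing V f <= pairing x f.
Proof.
move=> pD vV edges eta0 x Dx; rewrite leNgt; apply/negP => xV.
have [E [y [eE EV Ey]]] := polytope_edge pD vV Dx xV.
have [i /(_ y Ey) [a a0 ->]] := edges E eE EV.
by rewrite pairingDl pairingZl ltNge lerDl mulr_ge0.
Qed.

(** The coordinate forms of a lattice basis [e] are integral combinations of [eta], with matrix [K].
    This [K] inverts the matrix [M] of [eta] against [e], so its columns are the coordinates of the
    dual vectors, and their integrality puts these in [L]. *)
Lemma dual_basis (n : nat) (L : set t) (eta : 'I_n -> dual_space t) :
  is_lattice n L -> is_Zbasis (dual_lattice L) eta ->
  exists es : 'I_n -> t,
    [/\ forall i, L (es i),
        forall i j, pairing (eta i) (es j) = (i == j)%:R,
        forall v, v = \sum_i pairing (eta i) v *: es i &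
        forall x, x = \sum_i pairing x (es i) *: eta i].
Proof.
move=> [e be LE] [etaL etaspan].
have fe : free e by move: be; rewrite basisEfree => /andP[].
pose es_ (j : 'I_n) : dual_space t := linfun (coord e j : t -> R^o).
have es_E j k : pairing (es_ j) (tnth e k) = (j == k)%:R.
  by rewrite /pairing lfunE/= (tnth_nth 0) coord_free// eq_sym.
have L_e j : L (tnth e j).
  rewrite LE; exists (fun i => (i == j)%:Z).
  by rewrite (bigD1 j)//= eqxx mulr1z big1 ?addr0// => i /negbTE->; rewrite mulr0z.
have es_L j : dual_lattice L (es_ j).
  move=> v; rewrite LE => -[c ->]; rewrite pairing_sumr rpred_sum// => i _.
  by rewrite pairingMzr es_E rpredM ?intr_int ?natr_int.
have /choice [c cE] : forall j, exists c : 'rV[int]_n,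
    es_ j = \sum_(i < n) eta i *~ c 0 i.
  by move=> j; have [c [cE _]] := etaspan _ (es_L j); exists c.
pose M := \matrix_(i < n, j < n) pairing (eta i) (tnth e j).
pose K := \matrix_(j < n, i < n) ((c j 0 i)%:~R : R).
have KM : K *m M = 1%:M.
  apply/matrixP => j k; rewrite !mxE -es_E cE pairing_suml.
  by apply: eq_bigr => i _; rewrite !mxE pairingMzl.
have MK : M *m K = 1%:M by apply: mulmx1C.
pose es i := \sum_j tnth e j *~ c j 0 i.
have eval x i : pairing x (es i) = \sum_j pairing x (tnth e j) * K j i.
  by rewrite /es pairing_sumr; apply: eq_bigr => j _; rewrite pairingMzr !mxE mulrC.
have d i j : pairing (eta i) (es j) = (i == j)%:R.
  have := congr1 (fun A : 'M[R]_n => A i j) MK; rewrite !mxE => <-.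
  by rewrite eval; apply: eq_bigr => k _; rewrite !mxE.
have exp_e x y : (forall j, pairing x (tnth e j) = pairing y (tnth e j)) -> x = y.
  move=> xy; apply/lfunP => v; rewrite (coord_basis be (memvf v)) !linear_sum.
  by apply: eq_bigr => i _; rewrite !linearZ/= -tnth_nth; congr (_ *: _); exact: xy.
have exp_x x : x = \sum_i pairing x (es i) *: eta i.
  apply: exp_e => j; rewrite pairing_suml.
  pose X := \row_j pairing x (tnth e j).
  have XE : X = X *m K *m M by rewrite -mulmxA KM mulmx1.
  have := congr1 (fun A : 'rV[R]_n => A 0 j) XE; rewrite !mxE => ->.
  apply: eq_bigr => i _; rewrite pairingZl eval !mxE; congr (_ * _).
  by apply: eq_bigr => k _; rewrite !mxE.
exists es; split=> // [i|v].
  by rewrite LE; exists (fun j => c j 0 i).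
(* Vectors are separated by functionals, so the expansion of [v] can be tested against every [x],
   where it reduces to [exp_x]. *)
have sep w : (forall x, pairing x w = 0) -> w = 0.
  move=> xw; rewrite (coord_basis be (memvf w)) big1// => i _.
  by have := xw (es_ i); rewrite /pairing lfunE/= => ->; rewrite scale0r.
apply/eqP; rewrite -subr_eq0; apply/eqP/sep => x.
rewrite [LHS](_ : _ = pairing x v - pairing x (\sum_i pairing (eta i) v *: es i)).
  rewrite [X in pairing X v]exp_x pairing_suml pairing_sumr -sumrB big1// => i _.
  by rewrite pairingZl pairingZr mulrC subrr.
by rewrite /pairing linearB.
Qed.

(** Each dual vector [es i] is minimal on [D] at [V] and exposes a facet there. The primitive
    normals at [V] are therefore the [es i] up to a permutation, and sums of the [es i] expose the
    faces carrying the prescribed labels. *)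
Lemma delzant_vertex_structure (n d : nat) (L : set t) (D : set (dual_space t))
    (Fac : 'I_d -> set (dual_space t)) (u : 'I_d -> t) (V : dual_space t)
    (s : 'I_n -> 'I_d) :
  is_lattice n L -> is_delzant n L D -> facet_enumeration n D Fac ->
  (forall l, primitive_inward_normal L D (Fac l) (u l)) ->
  is_vertex D V -> range s = vertex_label Fac V ->
  (exists eta : 'I_n -> dual_space t, forall k, dual_lattice L (eta k) /\
     forall j, pairing (eta k) (u (s j)) = (k == j)%:R) /\
  (forall S : set 'I_d, S `<=` vertex_label Fac V -> labels_face D Fac S).
Proof.
move=> latL [polD delz] [Facinj Facr] unorm vV sr.
have [eta [Zeta edgex edges]] := delz V vV.
have [es [esL esd expv expx]] := dual_basis latL Zeta.
have DV : D V.
  by case: vV => _ [v]; move/seteqP => [/(_ V erefl)[]].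
have cone (f : t) x : (forall i, 0 <= pairing (eta i) f) -> D x ->
    pairing V f <= pairing x f.
  by move=> f0; exact: (delzant_vertex_cone polD vV edges f0).
(* An edge has dimension 1, so the one in direction [eta i] contains a point other than [V]. These
   points serve below as witnesses of what lies in a face. *)
have /choice [a aP] : forall i, exists a : R, 0 < a /\ D (V + a *: eta i).
  move=> i; have [E [[[_ [g EE]] [U [U1 EU Umin]]] EV Er]] := edgex i.
  have [y Ey yV] : exists2 y, E y & y != V.
    apply: contrapT => noy; have : (U <= 0)%VS.
      apply: Umin => x y Ex Ey; have h z : E z -> z = V.
        by move=> Ez; apply/eqP; apply: contrapT => /negP zV; apply: noy; exists z.
      by rewrite (h x)// (h y)// subrr mem0v.
    by move/dimvS; rewrite U1 dimv0.
  have [b b0 yE] := Er _ Ey; exists b; split.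
    rewrite lt_neqAle b0 andbT; apply: contraNneq yV => b0'.
    by rewrite yE -b0' scale0r addr0.
  by rewrite -yE; move: Ey; rewrite EE => -[].
have esp i j : 0 <= pairing (eta i) (es j) by rewrite esd ler0n.
(* The face exposed by the sum of the [es i] with [i] in [T]: each summand is minimal at [V], so the
   sum is minimal exactly where all of them are. *)
pose G (T : {set 'I_n}) := [set x | D x /\ forall i, i \in T ->
  pairing x (es i) = pairing V (es i)].
have Gface T : is_face D (G T).
  split; first by exists V; split.
  exists (\sum_(i in T) es i); apply/seteqP; split=> x /= [Dx HT]; split=> //.
    move=> y Dy; rewrite !pairing_sumr ler_sum// => i iT.
    by rewrite HT// cone.
  have := HT V DV; rewrite !pairing_sumr -subr_le0 -sumrB => le0.
  have ge i : i \in T -> 0 <= pairing x (es i) - pairing V (es i).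
    by move=> _; rewrite subr_ge0 cone.
  have /psumr_eq0P z : \sum_(i in T) (pairing x (es i) - pairing V (es i)) = 0.
    by apply/le_anti; rewrite le0 sumr_ge0.
  by move=> i iT; apply/eqP; rewrite -subr_eq0 z.
have GV T : G T V by split.
have Ga (T : {set 'I_n}) i : i \notin T -> G T (V + a i *: eta i).
  move=> iT; split; first by have [] := aP i.
  move=> j jT; rewrite pairingDl pairingZl esd.
  by rewrite (_ : i == j = false) ?mulr0 ?addr0//; apply: contraNF iT => /eqP->.
have Gna (T : {set 'I_n}) i : i \in T -> ~ G T (V + a i *: eta i).
  move=> iT [_ /(_ i iT)]; rewrite pairingDl pairingZl esd eqxx mulr1.
  by have [/gt_eqF a0 _] := aP i; move/eqP; rewrite -subr_eq0 addrC addKr a0.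
(* The directions of this face are spanned by the [n - 1] independent vectors [eta j] with
   [j != i]. *)
have Gfacet i : is_facet n D (G [set i]%SET).
  split=> //; exists (\sum_(j | j != i) <[eta j]>)%VS; split.
  - have indep : directv (\sum_(j | j != i) <[eta j]>)%VS.
      apply/directv_sum_independent => w wE w0 j ji.
      have /choice [b bE] : forall j, exists b : R, j != i -> w j = b *: eta j.
        move=> k; have [ki|ki] := boolP (k != i); last by exists 0.
        by have /vlineP[b ->] := wE k ki; exists b.
      have := congr1 (fun x => pairing x (es j)) w0.
      rewrite /pairing sum_lfunE zero_lfunE (bigD1 j)//= big1 ?addr0.
        move=> wj; rewrite bE//; suff -> : b j = 0 by rewrite scale0r.
        move: wj; rewrite bE// -/(pairing _ _) pairingZl esd eqxx mulr1.
        exact.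
      move=> k /andP[ki kj]; rewrite bE// -/(pairing _ _) pairingZl esd.
      by rewrite (negbTE kj) mulr0.
    have eta0 j : eta j != 0.
      apply/eqP => e0; have := esd j j; rewrite e0 /pairing zero_lfunE eqxx.
      by move/eqP; rewrite eq_sym oner_eq0.
    move/directvP: indep => /= ->.
    rewrite (eq_bigr (fun=> 1%N)) => [|j _]; last by rewrite dim_vline eta0.
    by rewrite sum1_card cardC1 card_ord.
  - move=> x y [Dx xi] [Dy yi].
    rewrite (expx (x - y)) (bigD1 i)//= pairingBl xi ?yi ?inE// subrr scale0r add0r.
    by apply: memv_sumr => j _; rewrite rpredZ// memv_line.
  - move=> W HW; apply/subv_sumP => j ji; rewrite -memvE.
    have [a0 _] := aP j.
    have : V + a j *: eta j - V \in W by apply: HW; [apply: Ga; rewrite inE|].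
    by rewrite addrC addKr => /(rpredZ (a j)^-1); rewrite scalerA mulVf ?scale1r// gt_eqF.
(* The facet exposed by [es i] sits at position [pi i] of the enumeration [s]. As an injective
   self-map of ['I_n], [pi] is a permutation, so these are all the facets through [V]. *)
have /choice [pi piE] : forall i, exists k, Fac (s k) = G [set i]%SET.
  move=> i; have : [set F | is_facet n D F] (G [set i]%SET) by exact: Gfacet.
  rewrite -Facr => -[l _ lE].
  have : vertex_label Fac V l by rewrite /vertex_label/= lE.
  by rewrite -sr => -[k _ kl]; exists k; rewrite kl.
have piinj : injective pi.
  move=> i j ij; apply/eqP; apply: contraT => nij.
  case: (@Gna [set i]%SET i); first by rewrite inE.
  by rewrite -piE ij piE; apply: Ga; rewrite inE.
have [rho rhoK piK] : bijective pi by exact: injF_bij.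
(* The normal kills every [eta j] with [j != i], so it is a multiple of [es i]. The factor is an
   integer because [eta i] is in the dual lattice, nonnegative because the normal points inward, and
   1 by primitivity. *)
have uE i : u (s (pi i)) = es i.
  have [[Lu prim] cst inw] := unorm (s (pi i)).
  rewrite piE in cst inw.
  have uj j : j != i -> pairing (eta j) (u (s (pi i))) = 0.
    move=> ji; have [a0 _] := aP j.
    have : pairing (V + a j *: eta j) (u (s (pi i))) = pairing V (u (s (pi i))).
      by apply: cst => //; apply: Ga; rewrite inE.
    rewrite pairingDl pairingZl => /eqP; rewrite -subr_eq0 addrC addKr.
    by rewrite mulf_eq0 gt_eqF//= => /eqP.
  have ui : u (s (pi i)) = pairing (eta i) (u (s (pi i))) *: es i.
    rewrite {1}(expv (u (s (pi i)))) (bigD1 i)//= big1 ?addr0// => j ji.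
    by rewrite uj// scale0r.
  have c0 : 0 <= pairing (eta i) (u (s (pi i))).
    have [a0 Da] := aP i.
    have := inw V (V + a i *: eta i) (GV _) Da.
    by rewrite pairingDl pairingZl lerDl pmulr_rge0.
  have : pairing (eta i) (u (s (pi i))) \is a Num.nat.
    by rewrite natrEint c0 andbT; apply: (Zeta.1 i).
  case/natrP => k kE; rewrite kE in ui.
  have := prim (es i) k (esL i); rewrite -scaler_nat => /(_ ui) k1.
  by rewrite ui k1 scale1r.
split.
  exists (eta \o rho) => k; split=> [|j]; first exact: Zeta.1.
  by rewrite -{1}(piK j) uE esd /= (can_eq piK).
move=> S SV.
have SE l : S l -> exists i, l = s (pi i).
  move=> /SV; rewrite -sr => -[k _ <-]; exists (rho k).
  by rewrite piK.
(* The indices of the dual vectors whose facets have their label in [S]. *)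
exists (G [set i | `[< S (s (pi i)) >]]%SET); first exact: Gface.
apply/seteqP; split=> l /=.
  move=> Sl; have [i li] := SE l Sl; rewrite li piE => x [Dx Hx]; split=> // j.
  by rewrite inE => /eqP->; apply: Hx; rewrite inE -li; apply/asboolP.
(* A facet containing this face passes through [V]. If its label were not in [S], the witness on the
   corresponding edge would lie in the face but not in the facet. *)
move=> sub; have : vertex_label Fac V l by apply: sub.
rewrite -sr => -[k _ kl]; apply: contrapT => nS.
have := sub (V + a (rho k) *: eta (rho k)); rewrite -kl -[in Fac _](piK k) piE.
move=> H; apply: (@Gna [set rho k]%SET (rho k)); first by rewrite inE.
apply: H; apply: Ga; rewrite inE piK kl.
by apply/asboolP.
Qed.

End Geometry.

(** * Smooth functions *)

Section Smooth.
Set Implicit Arguments.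
Unset Strict Implicit.

(** Functions that agree near [x] have the same first-order expansion at [x]. *)
Lemma near_eq_differentiable (R : numFieldType) (V W : normedModType R)
    (f g : V -> W) (x : V) :
  (\near x, f x = g x) -> differentiable f x -> differentiable g x.
Proof.
move=> fg /diff_locallyP[cf ff].
have gE : g \o shift x = cst (g x) + 'd f x +o_ (nbhs 0) id.
  apply/eqaddoP => e e0; move/eqaddoP: ff => /(_ e e0).
  have fg0 : \forall y \near 0, f (y + x) = g (y + x).
    have := fg; rewrite (near_shift 0 x) => h.
    by move: h; apply: filterS => y /=; rewrite subr0.
  move=> ff; near=> y.
  have -> : ((g \o shift x) - (cst (g x) + 'd f x)) y =
            ((f \o shift x) - (cst (f x) + 'd f x)) y.
    rewrite !fctE /= -(near fg0 y)//.
    by rewrite (nbhs_singleton fg).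
  by near: y.
have dg : 'd g x = 'd f x :> (V -> W) by apply: diff_unique.
by apply/diff_locallyP; rewrite dg.
Unshelve. all: by end_near. Qed.

Variables (R : realType) (V : normedModType R).
Implicit Types (O : set V) (f g : V -> R).

(** Grading by the number of directional derivatives lets closure under the algebraic operations go
    by induction on [k]; the condition of [smooth_on] is recovered by [Cn_iter_derive]. *)
Fixpoint Cn (k : nat) O f : Prop :=
  (forall x, O x -> differentiable f x) /\
  (if k is k'.+1 then forall v, Cn k' O ('D_v f) else True).

Lemma Cn_differentiable k O f x : Cn k O f -> O x -> differentiable f x.
Proof. by case: k => [|k] [fd _]; exact: fd. Qed.

Lemma Cn_pred k O f : Cn k.+1 O f -> Cn k O f.
Proof.
elim: k f => [|k IH] f [df Df]; split=> // v.
exact/IH/Df.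
Qed.

Lemma Cn_ext k O f g : open O -> (forall x, O x -> f x = g x) ->
  Cn k O f -> Cn k O g.
Proof.
move=> oO; elim: k f g => [|k IH] f g fg [df Df]; split=> //.
- move=> x Ox; apply: near_eq_differentiable (df _ Ox).
  by apply: filterS (open_nbhs_nbhs (conj oO Ox)).
- move=> x Ox; apply: near_eq_differentiable (df _ Ox).
  by apply: filterS (open_nbhs_nbhs (conj oO Ox)).
- move=> v; apply: IH (Df v) => x Ox; apply: near_eq_derive.
  by apply: filterS (open_nbhs_nbhs (conj oO Ox)).
Qed.

Lemma Cn_iter_derive O f : (forall k, Cn k O f) ->
  forall vs x, O x ->
    differentiable (foldr (fun v (g : V -> R) => 'D_v g) f vs) x.
Proof.
(* [foldr] applies the last vector of the list first, so the induction removes vectors at the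
   end. *)
move=> fC vs; elim/last_ind: vs f fC => [|vs v IH] f fC x Ox.
  exact: Cn_differentiable (fC 0%N) Ox.
rewrite foldr_rcons; apply: IH => // k.
by have [_] := fC k.+1; exact.
Qed.

Lemma Cn_cst k O (a : R) : Cn k O (cst a).
Proof.
elim: k a => [|k IH] a; split=> // v.
rewrite (_ : 'D_v (cst a) = cst 0); first exact: IH.
by apply/funext => x; rewrite derive_cst.
Qed.

Lemma CnD k O f g : open O -> Cn k O f -> Cn k O g -> Cn k O (f \+ g).
Proof.
move=> oO; elim: k f g => [|k IH] f g [df Df] [dg Dg]; split=> //.
- by move=> x Ox; apply: differentiableD; [exact: df|exact: dg].
- by move=> x Ox; apply: differentiableD; [exact: df|exact: dg].
- move=> v; apply: (Cn_ext oO _ (IH _ _ (Df v) (Dg v))) => x Ox /=.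
  by rewrite deriveD//; apply: diff_derivable; [exact: df|exact: dg].
Qed.

Lemma CnM k O f g : open O -> Cn k O f -> Cn k O g -> Cn k O (f \* g).
Proof.
move=> oO; elim: k f g => [|k IH] f g Cf Cg.
  split=> // x Ox; apply: differentiableM.
    exact: Cn_differentiable Cf Ox.
  exact: Cn_differentiable Cg Ox.
have [df Df] := Cf; have [dg Dg] := Cg; split=> [x Ox|v].
  by apply: differentiableM; [exact: df|exact: dg].
apply: (Cn_ext oO _ (CnD oO (IH _ _ (Cn_pred Cf) (Dg v))
                            (IH _ _ (Cn_pred Cg) (Df v)))) => x Ox /=.
by rewrite deriveM//; apply: diff_derivable; [exact: df|exact: dg].
Qed.

Lemma CnN k O f : open O -> Cn k O f -> Cn k O (\- f).
Proof.
move=> oO Cf; apply: (Cn_ext oO _ (CnM oO (Cn_cst k O (-1)) Cf)) => x _ /=.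
by rewrite mulN1r.
Qed.

Lemma CnV k O f : open O -> (forall x, O x -> f x != 0) ->
  Cn k O f -> Cn k O (fun x => (f x)^-1).
Proof.
move=> oO f0; elim: k => [|k IH] Cf.
  split=> // x Ox; apply: differentiableV; last exact: f0.
  exact: Cn_differentiable Cf Ox.
have [df Df] := Cf; split=> [x Ox|v].
  by apply: differentiableV; [exact: df|exact: f0].
have CV := IH (Cn_pred Cf).
apply: (Cn_ext oO _ (CnN oO (CnM oO (CnM oO CV CV) (Df v)))) => x Ox /=.
rewrite deriveV ?f0//; last by apply: diff_derivable; exact: df.
by rewrite -expr2 exprVn -mulNr.
Qed.

Lemma Cn_linear k O (f : {linear V -> R}) : continuous f -> Cn k O f.
Proof.
move=> cf; have df x : differentiable f x by exact: linear_differentiable.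
case: k => [|k]; split=> // v.
rewrite (_ : 'D_v f = cst (f v)); first exact: Cn_cst.
by apply/funext => x; rewrite deriveE// diff_lin.
Qed.

End Smooth.

(** * Smooth complex-valued functions, through real and imaginary parts *)

Section ComplexSmooth.
Set Implicit Arguments.
Unset Strict Implicit.
Variables (R : realType) (V : normedModType R).
Implicit Types (O : set V) (f g : V -> R[i]).

Lemma Re_mulc (x y : R[i]) : complex.Re (x * y) =
  complex.Re x * complex.Re y - complex.Im x * complex.Im y.
Proof. by case: x y => [? ?] [? ?]. Qed.

Lemma Im_mulc (x y : R[i]) : complex.Im (x * y) =
  complex.Re x * complex.Im y + complex.Im x * complex.Re y.
Proof. by case: x y => [? ?] [? ?]. Qed.

Lemma Re_invc (x : R[i]) : complex.Re x^-1 =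
  complex.Re x * (complex.Re x * complex.Re x + complex.Im x * complex.Im x)^-1.
Proof. by case: x. Qed.

Lemma Im_invc (x : R[i]) : complex.Im x^-1 =
  - (complex.Im x * (complex.Re x * complex.Re x + complex.Im x * complex.Im x)^-1).
Proof. by case: x. Qed.

Lemma sqr_norm_neq0 (x : R[i]) : x != 0 ->
  complex.Re x * complex.Re x + complex.Im x * complex.Im x != 0.
Proof.
case: x => a b; rewrite eq_complex /= -!expr2 => ab.
by rewrite paddr_eq0 ?sqr_ge0// !sqrf_eq0.
Qed.

Definition csmooth O f : Prop := forall k,
  Cn k O (@complex.Re R \o f) /\ Cn k O (@complex.Im R \o f).

Lemma csmooth_ext O f g : open O -> (forall x, O x -> f x = g x) ->
  csmooth O f -> csmooth O g.
Proof.
move=> oO fg Cf k; have [f1 f2] := Cf k.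
split; first by apply: (Cn_ext oO _ f1) => x Ox /=; rewrite fg.
by apply: (Cn_ext oO _ f2) => x Ox /=; rewrite fg.
Qed.

Lemma csmooth_cst O (a : R[i]) : csmooth O (cst a).
Proof. by move=> k; split; exact: Cn_cst. Qed.

Lemma csmoothM O f g : open O -> csmooth O f -> csmooth O g ->
  csmooth O (fun x => f x * g x).
Proof.
move=> oO Cf Cg k; have [f1 f2] := Cf k; have [g1 g2] := Cg k; split.
- apply: Cn_ext (CnD oO (CnM oO f1 g1) (CnN oO (CnM oO f2 g2))) => //.
  by move=> x _ /=; rewrite Re_mulc.
- apply: Cn_ext (CnD oO (CnM oO f1 g2) (CnM oO f2 g1)) => //.
  by move=> x _ /=; rewrite Im_mulc.
Qed.

Lemma csmoothV O f : open O -> (forall x, O x -> f x != 0) -> csmooth O f ->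
  csmooth O (fun x => (f x)^-1).
Proof.
move=> oO f0 Cf k; have [f1 f2] := Cf k.
have CV := CnV oO (fun x Ox => sqr_norm_neq0 (f0 x Ox))
  (CnD oO (CnM oO f1 f1) (CnM oO f2 f2)).
split.
- by apply: Cn_ext (CnM oO f1 CV) => // x _ /=; rewrite Re_invc.
- by apply: Cn_ext (CnN oO (CnM oO f2 CV)) => // x _ /=; rewrite Im_invc.
Qed.

Lemma csmoothX O f n : open O -> csmooth O f -> csmooth O (fun x => f x ^+ n).
Proof.
move=> oO Cf; elim: n => [|n IH].
  exact: (csmooth_ext oO _ (csmooth_cst O 1)).
by apply: (csmooth_ext oO _ (csmoothM oO Cf IH)) => x _; rewrite exprS.
Qed.

Lemma csmooth_exprz O f (m : int) : open O -> (forall x, O x -> f x != 0) ->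
  csmooth O f -> csmooth O (fun x => f x ^ m).
Proof.
move=> oO f0 Cf; case: m => m; first exact: csmoothX.
by apply: csmoothV (csmoothX _ oO Cf) => // x Ox; rewrite expf_neq0 ?f0.
Qed.

Lemma csmooth_prod (I : Type) (r : seq I) O (F : I -> V -> R[i]) : open O ->
  (forall i, csmooth O (F i)) -> csmooth O (fun x => \prod_(i <- r) F i x).
Proof.
move=> oO CF; elim: r => [|i r IH].
  by apply: (csmooth_ext oO _ (csmooth_cst O 1)) => x _; rewrite big_nil.
by apply: (csmooth_ext oO _ (csmoothM oO (CF i) IH)) => x _; rewrite big_cons.
Qed.

End ComplexSmooth.

(** * The bivectors in terms of radial and rotational fields *)

Section Wirtinger.
Set Implicit Arguments.
Unset Strict Implicit.
Variable R : realType.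
Local Notation C := R[i].

Lemma csmooth_coord (d : nat) (O : set 'rV[R]_(d + d)) (l : 'I_d) :
  csmooth O (fun x => cvec x 0 l).
Proof.
have Cco (j : 'I_(d + d)) k : Cn k O (fun x : 'rV[R]_(d + d) => x 0 j).
  have lin : linear (fun x : 'rV[R]_(d + d) => x 0 j : R^o).
    by move=> a x y; rewrite !mxE.
  pose fM := GRing.isLinear.Build _ _ _ _ _ lin.
  pose f : {linear 'rV[R]_(d + d) -> R} := HB.pack (fun x : 'rV[R]_(d + d) => x 0 j) fM.
  by apply: (@Cn_linear _ _ k O f) => x; exact: coord_continuous.
move=> k; split.
- rewrite (_ : _ \o _ = fun x : 'rV[R]_(d + d) => x 0 (lshift d l)); first exact: Cco.
  by apply/funext => x; rewrite /= !mxE.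
- rewrite (_ : _ \o _ = fun x : 'rV[R]_(d + d) => x 0 (rshift d l)); first exact: Cco.
  by apply/funext => x; rewrite /= !mxE.
Qed.

Lemma csmooth_smooth_on (d : nat) (O : set 'rV[C]_d) (h : 'rV[C]_d -> C) :
  csmooth (@cvec R d @^-1` O) (h \o @cvec R d) ->
  smooth_on O (@complex.Re R \o h) /\ smooth_on O (@complex.Im R \o h).
Proof.
move=> Ch; split=> vs z Oz; apply: (@Cn_iter_derive _ _ (@cvec R d @^-1` O)).
- by move=> k; have [] := Ch k.
- by rewrite /= rvecK.
- by move=> k; have [] := Ch k.
- by rewrite /= rvecK.
Qed.

(* [log_der xi l] is the derivative along the real vector field which generates
   the flow [z_l -> exp (s xi) z_l]: radial for xi = 1, rotational for xi = i. *)
Definition log_der (xi : C) (d : nat) (l : 'I_d) (f : 'rV[C]_d -> R)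
    (z : 'rV[C]_d) : R :=
  complex.Re (xi * z 0 l) * partial_x l f z + complex.Im (xi * z 0 l) * partial_y l f z.

(** The value of [E_p /\ T_q] on [(df, dg)], with [E] radial and [T] rotational. *)
Definition log_wedge (d : nat) (p q : 'I_d) (f g : 'rV[C]_d -> R) (z : 'rV[C]_d) : R :=
  log_der 1 p f z * log_der 'i%C q g z - log_der 'i%C q f z * log_der 1 p g z.

(** Since [z d/dz = (E - iT)/2] and its conjugate is [(E + iT)/2], each term of the bivector is
    [(i/4) (E + iT) /\ (E - iT) = (1/2) E /\ T]. *)
Lemma Pi_std_log (d : nat) (f g : 'rV[C]_d -> R) (z : 'rV[C]_d) :
  Pi_std f g z = (2^-1 * \sum_(l < d) log_wedge l l f g z)%:C%C.
Proof.
rewrite /Pi_std mulr_sumr rmorph_sum; apply: eq_bigr => l _.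
rewrite /wedge /log_wedge /partial_bar /partial /log_der.
rewrite -add_Re2_Im2; case: (z 0 l) => a b.
move: (partial_x l f z) (partial_y l f z) (partial_x l g z) (partial_y l g z).
move=> fx fy gx gy.
have -> : 2^-1 = (2^-1)%:C%C :> C by rewrite fmorphV rmorph_nat.
by rewrite mul1r; simpc => /=; congr (_ +i* _)%C; field.
Qed.

Lemma Pi_chart_log (n d : nat) (A : 'M[int]_(n, d - n)) (f g : 'rV[C]_n -> R)
    (w : 'rV[C]_n) :
  Pi_chart A f g w =
  (2^-1 * \sum_(p < n) \sum_(q < n) (BV A p q)%:~R * log_wedge p q f g w)%:C%C.
Proof.
have BVC p q : BV A p q = BV A q p.
  rewrite /BV !mxE eq_sym; congr (_ + _).
  by apply: eq_bigr => j _; rewrite !mxE mulrC.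
pose S p q := ((BV A p q)%:~R : R).
pose X p q : C := ('i)%C * (BV A p q)%:~R * (w 0 p)^*%C * w 0 q *
      wedge (partial_bar p) (partial q) f g w.
pose T p q : C := (2^-1 * (S p q * log_wedge p q f g w))%:C%C.
(* Single terms need not be real: they contain [(i/4) (E_p /\ E_q + T_p /\ T_q)]. This part is
   antisymmetric in [p], [q] and cancels against the symmetric [BV] once the terms [(p, q)] and
   [(q, p)] are added. *)
have XE p q : X p q + X q p = T p q + T q p.
  rewrite /T -rmorphD -mulrDr.
  rewrite /X /S [BV A q p]BVC.
  have -> : (BV A p q)%:~R = ((BV A p q)%:~R)%:C%C :> C by rewrite rmorph_int.
  move: ((BV A p q)%:~R : R) => c.
  rewrite /wedge /log_wedge /partial_bar /partial /log_der.
  case: (w 0 p) => a b; case: (w 0 q) => a' b'.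
  move: (partial_x p f w) (partial_y p f w) (partial_x p g w) (partial_y p g w).
  move: (partial_x q f w) (partial_y q f w) (partial_x q g w) (partial_y q g w).
  move=> ? ? ? ? ? ? ? ?.
  have -> : 2^-1 = (2^-1)%:C%C :> C by rewrite fmorphV rmorph_nat.
  by rewrite !mul1r; simpc => /=; congr (_ +i* _)%C; field.
rewrite /Pi_chart -/(\sum_p \sum_q X p q).
have two : (2 : C) != 0 by rewrite pnatr_eq0.
have -> : (2^-1 * \sum_p \sum_q (BV A p q)%:~R * log_wedge p q f g w)%:C%C =
    \sum_p \sum_q T p q.
  rewrite mulr_sumr rmorph_sum; apply: eq_bigr => p _.
  by rewrite mulr_sumr rmorph_sum.
have sym (Y : 'I_n -> 'I_n -> C) :
    2 * \sum_p \sum_q Y p q = \sum_p \sum_q (Y p q + Y q p).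
  rewrite mulr_natl mulr2n {2}exchange_big -big_split.
  by apply: eq_bigr => p _; rewrite -big_split.
apply: (mulfI two); rewrite [in LHS]sym [in RHS]sym.
by apply: eq_bigr => p _; apply: eq_bigr => q _; rewrite XE.
Qed.

End Wirtinger.

(** * Monomial maps *)

Section Pushforward.
Set Implicit Arguments.
Unset Strict Implicit.
Variable R : realType.
Local Notation C := R[i].

(** The velocity at time 0 of a curve in the complex plane with real parameter. *)
Definition cder (h : R -> C) (a : C) : Prop :=
  is_derive (0 : R) (1 : R) (@complex.Re R \o h) (complex.Re a) /\
  is_derive (0 : R) (1 : R) (@complex.Im R \o h) (complex.Im a).

Lemma cder_ext (h k : R -> C) a : h =1 k -> cder h a -> cder k a.
Proof. by move=> /funext->. Qed.

Lemma cder_cst (a : C) : cder (cst a) 0.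
Proof. by split; exact: is_derive_cst. Qed.

Lemma cder_line (xi : C) : cder (fun s : R => 1 + s%:C%C * xi) xi.
Proof.
have lin (a b : R) : is_derive (0 : R) (1 : R) (fun s : R => a + s * b) b.
  rewrite (_ : (fun s => a + s * b) = cst a + b \*: (@id R)).
    by apply: is_derive_eq; rewrite add0r [_ *: _]mulr1.
  by apply/funext => s; rewrite !fctE /= [_ *: _]mulrC.
split.
- rewrite (_ : _ \o _ = fun s : R => 1 + s * complex.Re xi); first exact: lin.
  by apply/funext => s /=; case: xi => a b; simpc.
- rewrite (_ : _ \o _ = fun s : R => 0 + s * complex.Im xi); first exact: lin.
  by apply/funext => s /=; case: xi => a b; simpc.
Qed.

Lemma cderM (h k : R -> C) a b : cder h a -> cder k b ->
  cder (fun s => h s * k s) (h 0 * b + k 0 * a).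
Proof.
move=> [h1 h2] [k1 k2]; split.
- rewrite (_ : _ \o _ = (@complex.Re R \o h) * (@complex.Re R \o k)
    - (@complex.Im R \o h) * (@complex.Im R \o k)); last first.
    by apply/funext => s; rewrite !fctE /= Re_mulc.
  apply: is_derive_eq; rewrite /= /GRing.scale /=.
  by case: (h 0) (k 0) a b {h1 h2 k1 k2} => [? ?] [? ?] [? ?] [? ?] /=; ring.
- rewrite (_ : _ \o _ = (@complex.Re R \o h) * (@complex.Im R \o k)
    + (@complex.Im R \o h) * (@complex.Re R \o k)); last first.
    by apply/funext => s; rewrite !fctE /= Im_mulc.
  apply: is_derive_eq; rewrite /= /GRing.scale /=.
  by case: (h 0) (k 0) a b {h1 h2 k1 k2} => [? ?] [? ?] [? ?] [? ?] /=; ring.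
Qed.

(** The curves raised to powers below all start at 1, so neither the inverse nor the power rule
    carries a factor [h 0]. *)
Lemma cderV (h : R -> C) a : h 0 = 1 -> cder h a -> cder (fun s => (h s)^-1) (- a).
Proof.
move=> h0 [h1 h2].
pose N := (@complex.Re R \o h) * (@complex.Re R \o h)
    + (@complex.Im R \o h) * (@complex.Im R \o h).
have dN : is_derive (0 : R) (1 : R) N (2 * complex.Re a).
  apply: is_derive_eq; rewrite /= h0 /GRing.scale /=; ring.
have N0 : N 0 = 1 by rewrite /N !fctE /= h0 /=; ring.
have dNV : is_derive (0 : R) (1 : R) (fun s => (N s)^-1) (- (2 * complex.Re a)).
  have := @is_deriveV _ N 0 (2 * complex.Re a) 1; rewrite N0 oner_neq0.
  by move=> /(_ isT dN); rewrite expr1n invr1 scaleN1r.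
split.
- rewrite (_ : _ \o _ = (@complex.Re R \o h) * (fun s => (N s)^-1)); last first.
    by apply/funext => s; rewrite !fctE /= Re_invc.
  apply: is_derive_eq; rewrite /= h0 N0 /GRing.scale /=.
  by case: a {h1 h2 dN dNV} => ? ? /=; field.
- rewrite (_ : _ \o _ = - ((@complex.Im R \o h) * (fun s => (N s)^-1))); last first.
    by apply/funext => s; rewrite !fctE /= Im_invc.
  apply: is_derive_eq; rewrite /= h0 N0 /GRing.scale /=.
  by case: a {h1 h2 dN dNV} => ? ? /=; field.
Qed.

Lemma cder_exprz (h : R -> C) a (m : int) : h 0 = 1 -> cder h a ->
  cder (fun s => h s ^ m) (m%:~R * a).
Proof.
move=> h0 ha.
have X (n : nat) : cder (fun s => h s ^+ n) (n%:R * a).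
  elim: n => [|n IH]; first by rewrite mul0r; exact: (cder_cst 1).
  have := cderM ha IH; rewrite h0 expr1n mul1r -mulrDl natr1 => H.
  by apply: cder_ext H => s; rewrite exprS.
case: m => m; first exact: X.
rewrite NegzE mulrNz mulNr.
by apply: (@cderV (fun s => h s ^+ m.+1)) (X m.+1); rewrite h0 expr1n.
Qed.

(** A negative power of 0 is 0 by the convention for inverses, so the map is total and
    multiplicative even where coordinates vanish. *)
Definition monomials (n d : nat) (c : 'M[int]_(n, d)) (z : 'rV[C]_d) : 'rV[C]_n :=
  \row_k \prod_l z 0 l ^ c k l.

Definition scale_coord (d : nat) (l : 'I_d) (x : C) (z : 'rV[C]_d) : 'rV[C]_d :=
  \row_j (z 0 j * (if j == l then x else 1)).

Lemma monomials_scale (n d : nat) (c : 'M[int]_(n, d)) l x z :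
  monomials c (scale_coord l x z) = \row_k (monomials c z 0 k * x ^ c k l).
Proof.
apply/rowP => k; rewrite !mxE.
under eq_bigr do rewrite !mxE expfzMl.
rewrite big_split /=; congr (_ * _).
rewrite (bigD1 l)//= eqxx big1 ?mulr1// => j /negbTE->.
by rewrite exp1rz.
Qed.

Lemma log_derE (d : nat) (xi : C) (l : 'I_d) (f : 'rV[C]_d -> R) (z : 'rV[C]_d) :
  differentiable (f \o @cvec R d) (rvec z) ->
  log_der xi l f z =
  'D_(rvec (\row_j (if j == l then xi * z 0 l else 0))) (f \o @cvec R d) (rvec z).
Proof.
move=> df; set v := rvec (\row__ _).
have -> : v = complex.Re (xi * z 0 l) *: delta_mx 0 (lshift d l) +
              complex.Im (xi * z 0 l) *: delta_mx 0 (rshift d l).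
  apply/rowP => j; rewrite /v /rvec -[j]splitK; case: (fintype.split j) => k /=.
    rewrite row_mxEl !mxE /= (inj_eq (@lshift_inj _ _)) eq_lrshift.
    by case: eqP => _; rewrite /= ?mulr1 !mulr0 ?addr0.
  rewrite row_mxEr !mxE /= (inj_eq (@rshift_inj _ _)) eq_rlshift.
  by case: eqP => _; rewrite /= ?mulr1 !mulr0 ?add0r.
rewrite /log_der /partial_x /partial_y !deriveE//.
by rewrite linearD !linearZ.
Qed.

Lemma rvecEl (d : nat) (x : 'rV[C]_d) j : rvec x 0 (lshift d j) = complex.Re (x 0 j).
Proof. by rewrite row_mxEl mxE. Qed.

Lemma rvecEr (d : nat) (x : 'rV[C]_d) j : rvec x 0 (rshift d j) = complex.Im (x 0 j).
Proof. by rewrite row_mxEr mxE. Qed.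

Lemma rvec_linear (d : nat) (a : R) (x y : 'rV[C]_d) :
  a *: rvec x + rvec y = rvec (a%:C%C *: x + y).
Proof.
rewrite /rvec scale_row_mx add_row_mx; congr row_mx; apply/rowP => j; rewrite !mxE.
  by case: (x 0 j) (y 0 j) => [? ?] [? ?] /=; rewrite mul0r subr0.
by case: (x 0 j) (y 0 j) => [? ?] [? ?] /=; rewrite mul0r addr0.
Qed.

Lemma derive_along (d : nat) (f : 'rV[R]_d -> R) x v :
  'D_v f x = 'D_1 (fun s : R => f (s *: v + x)) 0.
Proof.
rewrite /derive; set g1 := fun h => h^-1 *: _; set g2 := fun h => h^-1 *: _.
suff -> : g1 = g2 by [].
by rewrite funeqE /g1 /g2 => h /=; rewrite addr0 scale0r add0r [_%:A]mulr1.
Qed.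

(* Scaling z_l by 1 + s xi scales the k-th monomial by (1 + s xi) ^ (c k l). *)
Lemma log_der_monomials (n d : nat) (c : 'M[int]_(n, d)) (xi : C) (l : 'I_d)
    (f : 'rV[C]_d -> R) (phi : 'rV[C]_n -> R) (z : 'rV[C]_d) :
  (\forall x \near rvec z, f (cvec x) = phi (monomials c (cvec x))) ->
  differentiable (f \o @cvec R d) (rvec z) ->
  differentiable (phi \o @cvec R n) (rvec (monomials c z)) ->
  log_der xi l f z = \sum_k (c k l)%:~R * log_der xi k phi (monomials c z).
Proof.
move=> fphi df dphi; rewrite log_derE// derive_along.
set v := rvec (\row__ _); set w := monomials c z.
(* The image under the monomial map of the straight line that multiplies [z_l] by [1 + s xi]. *)
pose gam (s : R) := rvec (\row_k (w 0 k * (1 + s%:C%C * xi) ^ c k l)).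
have gamE s : rvec (monomials c (cvec (s *: v + rvec z))) = gam s.
  rewrite /gam -monomials_scale; congr (rvec (monomials c _)).
  rewrite rvec_linear rvecK; apply/rowP => j; rewrite !mxE.
  case: eqP => [->|_]; last by rewrite mulr0 add0r mulr1.
  by ring.
have cder_k k : cder (fun s : R => w 0 k * (1 + s%:C%C * xi) ^ c k l)
    ((c k l)%:~R * (xi * w 0 k)).
  have h0 : 1 + (0 : R)%:C%C * xi = 1 by rewrite mul0r addr0.
  have := cderM (cder_cst (w 0 k)) (cder_exprz (c k l) h0 (cder_line xi)).
  by rewrite /= mulr0 addr0 mulrCA [w 0 k * xi]mulrC.
(* The velocity of [gam] at 0, already written as the combination of the vectors that [log_derE]
   attaches to the coordinates of the target. *)
pose dgam := \sum_k (c k l)%:~R *: rvec (\row_j (if j == k then xi * w 0 k else 0)).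
have gam_j j : is_derive (0 : R) (1 : R) (fun s => gam s 0 j) (dgam 0 j).
  rewrite /dgam summxE -[j]splitK; case: (fintype.split j) => k /=.
    have := (cder_k k).1; rewrite [X in is_derive _ _ X _](_ : _ = fun s => gam s 0 (lshift n k)).
      move=> H; apply: is_derive_eq H _.
      rewrite (bigD1 k)//= big1 ?addr0; last first.
        by move=> i ik; rewrite mxE rvecEl mxE eq_sym (negbTE ik) /= mulr0.
      rewrite [RHS]mxE rvecEl [in RHS]mxE eqxx Re_mulc.
      have -> : (c k l)%:~R = ((c k l)%:~R)%:C%C :> C by rewrite rmorph_int.
      by rewrite /= mul0r subr0.
    by apply/funext => s; rewrite /gam rvecEl [in RHS]mxE.
  have := (cder_k k).2; rewrite [X in is_derive _ _ X _](_ : _ = fun s => gam s 0 (rshift n k)).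
    move=> H; apply: is_derive_eq H _.
    rewrite (bigD1 k)//= big1 ?addr0; last first.
      by move=> i ik; rewrite mxE rvecEr mxE eq_sym (negbTE ik) /= mulr0.
    rewrite [RHS]mxE rvecEr [in RHS]mxE eqxx Im_mulc.
    have -> : (c k l)%:~R = ((c k l)%:~R)%:C%C :> C by rewrite rmorph_int.
    by rewrite /= mul0r addr0.
  by apply/funext => s; rewrite /gam rvecEr [in RHS]mxE.
have dgam0 : derivable gam 0 1.
  by apply/derivable_mxP => i j; rewrite ord1; have [] := gam_j j.
have gam0 : gam 0 = rvec w.
  rewrite /gam; congr rvec; apply/rowP => k.
  by rewrite mxE mul0r addr0 exp1rz mulr1.
(* The factorization of [f] through [phi] is known only near [z], which the line does not leave for
   small [s]. *)
have near0 : \forall s \near (0 : R), f (cvec (s *: v + rvec z)) = (phi \o @cvec R n) (gam s).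
  have cont : {for (0 : R), continuous (fun s : R => s *: v + rvec z)}.
    apply: differentiable_continuous.
    by apply: differentiableD => //; apply: differentiableZl.
  have : nbhs (0 *: v + rvec z)
      [set x | f (cvec x) = phi (monomials c (cvec x))] by rewrite scale0r add0r.
  move=> /cont H; near=> s; rewrite /= -gamE rvecK.
  by near: s.
rewrite (near_eq_derive _ near0).
have dg : differentiable gam 0 by apply/derivable1_diffP.
have dphi' : differentiable (phi \o @cvec R n) (gam 0) by rewrite gam0.
rewrite -/((phi \o @cvec R n) \o gam) deriveE; last exact: differentiable_comp.
rewrite diff_comp//= gam0.
have -> : 'd gam 0 1 = dgam.
  rewrite -deriveE// derive_mx//; apply/matrixP => i j; rewrite mxE ord1.
  by have [_] := gam_j j.
rewrite /dgam linear_sum; apply: eq_bigr => k _.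
by rewrite linearZ log_derE// deriveE.
Unshelve. all: by end_near. Qed.

End Pushforward.

(** * The exponents of a vertex chart *)

Section Exponents.
Set Implicit Arguments.
Unset Strict Implicit.

Lemma increasing_enumeration_inj (k d : nat) (s : 'I_k -> 'I_d) (S : set 'I_d) :
  increasing_enumeration s S -> injective s.
Proof.
move=> [inc _] i j sij; apply/val_inj.
by case: (ltngtP i j) => // /inc; rewrite sij ltnn.
Qed.

Variables (n d : nat) (s : 'I_n -> 'I_d) (s' : 'I_(d - n) -> 'I_d) (S : set 'I_d).
Hypothesis s_enum : increasing_enumeration s S.
Hypothesis s'_enum : increasing_enumeration s' (~` S).

Let s_inj := increasing_enumeration_inj s_enum.
Let s'_inj := increasing_enumeration_inj s'_enum.

Lemma enum_in k : S (s k).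
Proof. by have [_ <-] := s_enum; exists k. Qed.

Lemma enumC_notin m : ~ S (s' m).
Proof. by have [_ ranges'] := s'_enum; rewrite -[~ _]/((~` S) _) -ranges'; exists m. Qed.

Lemma enum_neq k m : s k == s' m = false.
Proof. by apply/eqP => e; apply: (@enumC_notin m); rewrite -e; exact: enum_in. Qed.

Variant enum_spec (l : 'I_d) : Prop :=
  | EnumIn k of l = s k
  | EnumOut m of l = s' m.

Lemma label_enumP l : enum_spec l.
Proof.
have [Sl|Sl] := pselect (S l).
  by move: Sl; have [_ <-] := s_enum => -[k _ <-]; apply: EnumIn.
have : (~` S) l by [].
by have [_ <-] := s'_enum => -[m _ <-]; apply: EnumOut.
Qed.

Lemma big_enum_split (T : Type) (idx : T) (op : Monoid.com_law idx) (F : 'I_d -> T) :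
  \big[op/idx]_l F l = op (\big[op/idx]_k F (s k)) (\big[op/idx]_m F (s' m)).
Proof.
pose h (x : 'I_n + 'I_(d - n)) := match x with inl k => s k | inr m => s' m end.
have h_inj : injective h.
  move=> [a|a] [b|b] /= ab.
  - by rewrite (s_inj ab).
  - by have := enum_neq a b; rewrite ab eqxx.
  - by have := enum_neq b a; rewrite ab eqxx.
  - by rewrite (s'_inj ab).
(* Subtraction is truncated, so [n + (d - n) = d] requires this bound; it comes from the injectivity
   of [s]. *)
have le_nd : (n <= d)%N by have := leq_card s s_inj; rewrite !card_ord.
have h_bij : bijective h.
  by apply: inj_card_bij => //; rewrite card_sum !card_ord subnKC.
by rewrite (reindex h) /=; [rewrite big_sumType|exact: onW_bij].
Qed.

Variable A : 'M[int]_(n, d - n).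

(* The coordinates of the normals in the basis [u (s k)]: see [normal_expansion]. *)
Definition vertex_exponent : 'M[int]_(n, d) :=
  \matrix_(k, l) ((l == s k)%:R - \sum_m A k m * (l == s' m)%:R).

Lemma vertex_exponent_in k j : vertex_exponent k (s j) = (k == j)%:R.
Proof.
rewrite mxE (inj_eq s_inj) eq_sym big1 ?subr0// => m _.
by rewrite enum_neq mulr0.
Qed.

Lemma vertex_exponent_out k m : vertex_exponent k (s' m) = - A k m.
Proof.
rewrite mxE eq_sym enum_neq sub0r (bigD1 m)//= eqxx mulr1 big1 ?addr0//.
by move=> j jm; rewrite (inj_eq s'_inj) eq_sym (negbTE jm) mulr0.
Qed.

(** With the columns ordered by [s] and then [s'], the exponent matrix is the block row
    [(1 | -A)]. *)
Lemma BV_vertex_exponent p q :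
  BV A p q = \sum_l vertex_exponent p l * vertex_exponent q l.
Proof.
rewrite big_enum_split /BV !mxE; congr (_ + _).
  rewrite (bigD1 p)//= big1 => [|k kp].
    by rewrite !vertex_exponent_in eqxx mul1r addr0 eq_sym.
  by rewrite vertex_exponent_in eq_sym (negbTE kp) mul0r.
by apply: eq_bigr => m _; rewrite !vertex_exponent_out mulrNN mxE.
Qed.

Variable R : realType.
Local Notation C := R[i].

Lemma wcoord_monomials (z : 'rV[C]_d) : wcoord s s' A z = monomials vertex_exponent z.
Proof.
apply/rowP => k; rewrite !mxE big_enum_split /=; congr (_ * _).
  rewrite (bigD1 k)//= vertex_exponent_in eqxx expr1z big1 ?mulr1// => j jk.
  by rewrite vertex_exponent_in eq_sym (negbTE jk) expr0z.
by apply: eq_bigr => m _; rewrite vertex_exponent_out.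
Qed.

Lemma monomialsM (c : 'M[int]_(n, d)) (z z' : 'rV[C]_d) :
  monomials c (\row_l (z 0 l * z' 0 l)) =
  \row_k (monomials c z 0 k * monomials c z' 0 k).
Proof.
apply/rowP => k; rewrite !mxE -big_split.
by apply: eq_bigr => l _; rewrite mxE expfzMl.
Qed.

(** A global section of the chart: [w_k] in position [s k] and 1 elsewhere. The sums of indicators
    avoid inverting the enumerations. *)
Definition wsection (w : 'rV[C]_n) : 'rV[C]_d :=
  \row_l (\sum_k w 0 k * (l == s k)%:R + \sum_m (l == s' m)%:R).

Lemma wsection_in w k : wsection w 0 (s k) = w 0 k.
Proof.
rewrite mxE (bigD1 k)//= eqxx mulr1 !big1 ?addr0// => [m _|j jk].
  by rewrite enum_neq.
by rewrite (inj_eq s_inj) eq_sym (negbTE jk) mulr0.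
Qed.

Lemma wsection_out w m : wsection w 0 (s' m) = 1.
Proof.
rewrite mxE big1 => [|k _]; last by rewrite eq_sym enum_neq mulr0.
rewrite (bigD1 m)//= eqxx add0r big1 ?addr0// => j jm.
by rewrite (inj_eq s'_inj) eq_sym (negbTE jm).
Qed.

Lemma wsectionK w : wcoord s s' A (wsection w) = w.
Proof.
apply/rowP => k; rewrite mxE wsection_in big1 ?mulr1// => m _.
by rewrite wsection_out exp1rz.
Qed.

Lemma differentiable_wsection (x : 'rV[R]_(n + n)) :
  differentiable (fun y : 'rV[R]_(n + n) => rvec (wsection (cvec y))) x.
Proof.
have diff_rV (h : 'rV[R]_(n + n) -> 'rV[R]_(d + d)) :
    (forall j, differentiable (fun y => h y 0 j) x) -> differentiable h x.
  move=> dh; rewrite (_ : h = \sum_j (fun y => h y 0 j *: delta_mx 0 j)).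
    by apply: differentiable_sum => j; apply: differentiableZl.
  by apply/funext => y; rewrite fct_sumE [LHS]row_sum_delta.
have coord (k : 'I_n) := @csmooth_coord R n setT k 0%N.
apply: diff_rV => j; rewrite -[j]splitK; case: (fintype.split j) => l /=.
- rewrite (_ : (fun y => _) = @complex.Re R \o (fun y => wsection (cvec y) 0 l)).
    case: (label_enumP l) => [k ->|m ->].
      rewrite (_ : _ \o _ = @complex.Re R \o (fun y => cvec y 0 k)).
        exact: Cn_differentiable (coord k).1 _.
      by apply/funext => y; rewrite /= wsection_in.
    rewrite (_ : _ \o _ = cst 1)//.
    by apply/funext => y; rewrite /= wsection_out.
  by apply/funext => y; rewrite rvecEl.
- rewrite (_ : (fun y => _) = @complex.Im R \o (fun y => wsection (cvec y) 0 l)).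
    case: (label_enumP l) => [k ->|m ->].
      rewrite (_ : _ \o _ = @complex.Im R \o (fun y => cvec y 0 k)).
        exact: Cn_differentiable (coord k).2 _.
      by apply/funext => y; rewrite /= wsection_in.
    rewrite (_ : _ \o _ = cst 0)//.
    by apply/funext => y; rewrite /= wsection_out.
  by apply/funext => y; rewrite rvecEr.
Qed.

End Exponents.

(** * Symmetry and positivity of the matrix of a vertex *)

Section PositiveDefinite.
Set Implicit Arguments.
Unset Strict Implicit.

Lemma BV_tr (n d : nat) (A : 'M[int]_(n, d - n)) : (BV A)^T = BV A.
Proof. by rewrite /BV linearD /= trmx1 trmx_mul trmxK. Qed.

(** The form splits as [|v|^2 + |v A|^2], whose first term is already positive for [v != 0]. *)
Lemma BV_positive_definite (R : realType) (n d : nat) (A : 'M[int]_(n, d - n)) :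
  positive_definite R (BV A).
Proof.
move=> v v0.
have sqr m (x : 'rV[R]_m) : (x *m x^T) 0 0 = \sum_j x 0 j ^+ 2.
  by rewrite mxE; apply: eq_bigr => j _; rewrite mxE.
rewrite /BV map_mxD map_mx1 map_mxM -map_trmx mulmxDr mulmx1 mulmxDl.
rewrite mulmxA -mulmxA -trmx_mul mxE !sqr.
apply: ltr_pwDl; last by apply: sumr_ge0 => j _; exact: sqr_ge0.
rewrite lt_neqAle sumr_ge0 ?andbT; last by move=> j _; exact: sqr_ge0.
apply: contra v0; rewrite eq_sym psumr_eq0 => [/allP h|j _]; last exact: sqr_ge0.
apply/eqP/rowP => j; rewrite mxE; apply/eqP.
by have := h j (mem_index_enum j); rewrite sqrf_eq0.
Qed.

End PositiveDefinite.

(** * Linear and quadratic forms in the real coordinates *)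

Section QuadraticForms.
Set Implicit Arguments.
Unset Strict Implicit.
Variables (R : realType) (n : nat).
Local Notation C := R[i].
Implicit Types h : 'rV[C]_n -> R.

Definition linform h := exists a : 'cV[R]_(n + n), forall w, h w = (rvec w *m a) 0 0.

Definition quadform h := exists Q : 'M[R]_(n + n),
  forall w, h w = (rvec w *m Q *m (rvec w)^T) 0 0.

Lemma linformD h1 h2 : linform h1 -> linform h2 -> linform (fun w => h1 w + h2 w).
Proof.
by move=> [a aE] [b bE]; exists (a + b) => w; rewrite mulmxDr mxE aE bE.
Qed.

Lemma linformZ (c : R) h : linform h -> linform (fun w => c * h w).
Proof. by move=> [a aE]; exists (c *: a) => w; rewrite -scalemxAr mxE aE. Qed.

Lemma linform_coord j : linform (fun w => rvec w 0 j).
Proof.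
exists (delta_mx j 0) => w.
by rewrite -colE !mxE.
Qed.

Lemma quadformM h1 h2 : linform h1 -> linform h2 -> quadform (fun w => h1 w * h2 w).
Proof.
move=> [a aE] [b bE]; exists (a *m b^T) => w.
rewrite mulmxA -mulmxA -trmx_mul mxE big_ord1 aE bE.
by congr (_ * _); rewrite [RHS]mxE.
Qed.

Lemma quadformD h1 h2 : quadform h1 -> quadform h2 -> quadform (fun w => h1 w + h2 w).
Proof.
by move=> [P PE] [Q QE]; exists (P + Q) => w; rewrite mulmxDr mulmxDl mxE PE QE.
Qed.

Lemma quadformZ (c : R) h : quadform h -> quadform (fun w => c * h w).
Proof.
by move=> [Q QE]; exists (c *: Q) => w; rewrite -scalemxAr -scalemxAl mxE QE.
Qed.

Lemma quadform_sum (I : finType) (F : I -> 'rV[C]_n -> R) :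
  (forall i, quadform (F i)) -> quadform (fun w => \sum_i F i w).
Proof.
move=> /choice[Q QE]; exists (\sum_i Q i) => w.
rewrite mulmx_sumr mulmx_suml summxE.
by apply: eq_bigr => i _; rewrite QE.
Qed.

(** The radial and rotational fields have linear coefficients, so a wedge of two of them is
    quadratic on coordinate functions. *)
Lemma log_der_coord (xi : C) k j : linform (log_der xi k (fun w => rvec w 0 j)).
Proof.
have der v (w : 'rV[C]_n) : 'D_v ((fun w => rvec w 0 j) \o @cvec R n) (rvec w) = v 0 j.
  have lin : linear (fun x : 'rV[R]_(n + n) => x 0 j : R^o).
    by move=> a x y; rewrite !mxE.
  pose fM := GRing.isLinear.Build _ _ _ _ _ lin.
  pose f : {linear 'rV[R]_(n + n) -> R} := HB.pack (fun x : 'rV[R]_(n + n) => x 0 j) fM.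
  rewrite (_ : _ \o _ = f); last by apply/funext => x /=; rewrite cvecK.
  have cf : continuous f by move=> x; exact: coord_continuous.
  by rewrite deriveE ?diff_lin//; exact: linear_differentiable.
rewrite (_ : log_der _ _ _ = fun w =>
    (delta_mx 0 (lshift n k) : 'rV[R]_(n + n)) 0 j *
      (complex.Re xi * rvec w 0 (lshift n k) + - complex.Im xi * rvec w 0 (rshift n k)) +
    (delta_mx 0 (rshift n k) : 'rV[R]_(n + n)) 0 j *
      (complex.Re xi * rvec w 0 (rshift n k) + complex.Im xi * rvec w 0 (lshift n k))).
  apply: linformD; apply: linformZ; apply: linformD;
    by apply: linformZ; exact: linform_coord.
apply/funext => w; rewrite /log_der /partial_x /partial_y !der !rvecEl !rvecEr.
by rewrite Re_mulc Im_mulc; ring.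
Qed.

End QuadraticForms.

(** * The toric quotient and its vertex charts *)

Section ToricQuotient.
Set Implicit Arguments.
Unset Strict Implicit.
Variables (R : realType) (t : vectType R) (d : nat) (L : set t) (u : 'I_d -> t).
Local Notation C := R[i].
Local Notation NC := (@NC R t d L u).
Local Notation orbit := (@NC_orbit R t d L u).
Implicit Types z : 'rV[C]_d.

Lemma NC1 : NC (const_mx 1).
Proof.
split=> [l|m _]; first by rewrite mxE oner_neq0.
by rewrite big1// => l _; rewrite mxE exp1rz.
Qed.

Lemma NCM a b : NC a -> NC b -> NC (\row_l (a 0 l * b 0 l)).
Proof.
move=> [a0 a1] [b0 b1]; split=> [l|m mL]; first by rewrite mxE mulf_neq0.
under eq_bigr do rewrite mxE expfzMl.
by rewrite big_split /= a1// b1// mulr1.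
Qed.

Lemma NCV a : NC a -> NC (\row_l (a 0 l)^-1).
Proof.
move=> [a0 a1]; split=> [l|m mL]; first by rewrite mxE invr_eq0.
under eq_bigr do rewrite mxE exprz_inv -invr_expz.
by rewrite prodfV a1// invr1.
Qed.

Lemma orbit_refl z : orbit z z.
Proof. by exists (const_mx 1); [exact: NC1|apply/rowP => l; rewrite !mxE mul1r]. Qed.

Lemma orbit_eq z z' : orbit z z' -> orbit z' = orbit z.
Proof.
move=> [a Na z'E]; apply/seteqP; split=> y [b Nb ->].
  exists (\row_l (b 0 l * a 0 l)); first exact: NCM.
  by apply/rowP => l; rewrite z'E !mxE mulrA.
exists (\row_l (b 0 l * (\row_l (a 0 l)^-1) 0 l)); first exact: NCM (NCV Na).
apply/rowP => l; rewrite z'E !mxE -mulrA; congr (_ * _).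
by rewrite mulKf//; case: Na.
Qed.

End ToricQuotient.

(** * The chart at a vertex and the bracket in it *)

Section VertexChart.
Set Implicit Arguments.
Unset Strict Implicit.
Variables (R : realType) (t : vectType R) (n d : nat) (L : set t).
Variables (Fac : 'I_d -> set (dual_space t)) (u : 'I_d -> t) (V : dual_space t).
Variables (s : 'I_n -> 'I_d) (s' : 'I_(d - n) -> 'I_d) (A : 'M[int]_(n, d - n)).
Local Notation C := R[i].
Local Notation orbit := (@NC_orbit R t d L u).
Local Notation UV := (@U_vertex R t d Fac V).
Local Notation c := (vertex_exponent s s' A).
Local Notation w_ := (@wcoord R n d s s' A).

Hypothesis u_lattice : forall l, L (u l).
Hypothesis s_enum : increasing_enumeration s (vertex_label Fac V).
Hypothesis s'_enum : increasing_enumeration s' (~` vertex_label Fac V).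
Hypothesis A_vertex : is_vertex_matrix u s s' A.
Variable eta : 'I_n -> dual_space t.
Hypothesis eta_dual : forall k, dual_lattice L (eta k) /\
  forall j, pairing (eta k) (u (s j)) = (k == j)%:R.

Lemma normal_expansion l : u l = \sum_k u (s k) *~ c k l.
Proof.
case: (label_enumP s_enum s'_enum l) => [j ->|m ->].
  rewrite (bigD1 j)//= (vertex_exponent_in s_enum s'_enum) eqxx mulr1z big1 ?addr0//.
  by move=> k kj; rewrite (vertex_exponent_in s_enum s'_enum) (negbTE kj) mulr0z.
have /eqP := A_vertex m; rewrite addr_eq0 => /eqP->.
rewrite -sumrN; apply: eq_bigr => k _.
by rewrite (vertex_exponent_out s_enum s'_enum) mulrNz.
Qed.

(** Pairing the normals with [eta k] reads off row [k] of the exponents, so the k-th monomial is the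
    character of [eta k]. Conversely the character of any [m] is a product of these monomials with
    exponents [pairing m (u (s k))]. *)
Lemma NC_monomials a : NC L u a <-> (forall l, a 0 l != 0) /\ monomials c a = const_mx 1.
Proof.
split=> [[a0 a1]|[a0 a1]]; split=> //.
  apply/rowP => k; rewrite !mxE -[RHS](a1 (eta k)); last by case: (eta_dual k).
  apply: eq_bigr => l _; congr (_ ^ _).
  rewrite (normal_expansion l) pairing_sumr (bigD1 k)//= big1 ?addr0.
    by rewrite pairingMzr (eta_dual k).2 eqxx mulr1 intrKfloor.
  by move=> j jk; rewrite pairingMzr (eta_dual k).2 eq_sym (negbTE jk) mulr0.
move=> m mL.
have mu k : pairing m (u (s k)) = (Num.floor (pairing m (u (s k))))%:~R.
  by rewrite floorK//; exact: mL.
transitivity (\prod_k monomials c a 0 k ^ Num.floor (pairing m (u (s k)))); last first.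
  by rewrite big1// => k _; rewrite a1 mxE exp1rz.
transitivity (\prod_k \prod_l a 0 l ^ (c k l * Num.floor (pairing m (u (s k))))).
  rewrite exchange_big; apply: eq_bigr => l _ /=.
  have -> : Num.floor (pairing m (u l)) =
      \sum_k c k l * Num.floor (pairing m (u (s k))).
    apply: (@intr_inj R); rewrite floorK; last exact: mL.
    rewrite {1}(normal_expansion l) pairing_sumr rmorph_sum.
    by apply: eq_bigr => k _; rewrite pairingMzr mu rmorphM /= intrKfloor.
  by elim/big_rec2: _ => [|k x y _ <-]; rewrite ?expr0z// expfzDr.
apply: eq_bigr => k _; rewrite mxE.
elim/big_rec2: _ => [|l x y _ ->]; first by rewrite exp1rz.
by rewrite expfzMl exprz_exp.
Qed.

Lemma wcoord_orbit z z' : orbit z z' -> w_ z' = w_ z.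
Proof.
move=> [a /NC_monomials[_ a1] ->]; rewrite !(wcoord_monomials s_enum s'_enum).
by rewrite monomialsM a1; apply/rowP => k; rewrite !mxE mul1r.
Qed.

Lemma orbit_wcoord z z' : UV z -> UV z' -> w_ z = w_ z' -> orbit z z'.
Proof.
move=> Uz Uz' ww.
have z0 m : z 0 (s' m) != 0 by apply/Uz/(enumC_notin s'_enum).
have z'0 m : z' 0 (s' m) != 0 by apply/Uz'/(enumC_notin s'_enum).
pose r m := z' 0 (s' m) / z 0 (s' m).
have r0 m : r m != 0 by rewrite mulf_neq0 ?invr_eq0.
(* The coordinates of [z] at [s k] may vanish, so only the ratios at [s' m] are available. They are
   [r m] there, and the entries at [s k] are then forced by requiring all monomials of [a] to be
   1. *)
pose a := \row_l (\prod_m r m ^ (\sum_k A k m * (l == s k)%:R + (l == s' m)%:R)).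
have as' m : a 0 (s' m) = r m.
  rewrite mxE (bigD1 m)//= eqxx big1 => [|k _].
    rewrite add0r expr1z big1 ?mulr1// => j jm.
    rewrite big1 => [|k _]; last by rewrite eq_sym (enum_neq s_enum s'_enum) mulr0.
    by rewrite (inj_eq (increasing_enumeration_inj s'_enum)) eq_sym (negbTE jm) expr0z.
  by rewrite eq_sym (enum_neq s_enum s'_enum) mulr0.
have as_ k : a 0 (s k) = \prod_m r m ^ A k m.
  rewrite mxE; apply: eq_bigr => m _; rewrite (enum_neq s_enum s'_enum) addr0.
  rewrite (bigD1 k)//= eqxx mulr1 big1 ?addr0// => j jk.
  by rewrite (inj_eq (increasing_enumeration_inj s_enum)) eq_sym (negbTE jk) mulr0.
exists a.
  apply/NC_monomials; split.
    by move=> l; rewrite mxE; apply/prodf_neq0 => m _; rewrite expfz_neq0.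
  rewrite -(wcoord_monomials s_enum s'_enum); apply/rowP => k; rewrite [LHS]mxE [RHS]mxE as_.
  rewrite -big_split /= big1// => m _.
  by rewrite as' -expfzDr// subrr expr0z.
apply/rowP => l; rewrite [RHS]mxE; case: (label_enumP s_enum s'_enum l) => [k ->|m ->].
  rewrite as_.
  have := congr1 (fun x : 'rV[C]_n => x 0 k) ww; rewrite !mxE => wk.
  have P0 : \prod_m z' 0 (s' m) ^ (- A k m) != 0.
    by apply/prodf_neq0 => m _; rewrite expfz_neq0.
  (* The remaining coordinates are compared through [w_k], after multiplication by its nonvanishing
     factor. *)
  apply: (mulIf P0); rewrite -wk mulrAC mulrC; congr (_ * _).
  rewrite -big_split; apply: eq_bigr => m _ /=.
  rewrite /r expfzMl mulrAC -expfzDr// subrr expr0z mul1r.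
  by rewrite exprz_inv.
by rewrite as' /r mulfVK.
Qed.

Lemma UV_orbit z z' : orbit z z' -> UV z -> UV z'.
Proof. by move=> [a [a0 _] ->] Uz l lV; rewrite mxE mulf_neq0// Uz. Qed.

Lemma chart_orbit z : chart s s' A (orbit z) = w_ z.
Proof.
apply: wcoord_orbit; rewrite /=.
(* The default 0 is not reached, since the orbit contains [z]. *)
by case: xgetP => [y -> //|/(_ z) []]; exact: orbit_refl.
Qed.

Local Notation ch := (@chart R n d s s' A).
Local Notation chi := (@chart_inv R t n d L Fac u s s' A V).
Local Notation dom := (@chart_domain R t d L Fac u V).

(** [orbit_wcoord] makes the chart injective on its domain, where the partial inverse is therefore a
    true inverse. *)
Lemma chart_invK z : UV z -> chi (w_ z) = orbit z.
Proof.
move=> Uz; rewrite -chart_orbit /chart_inv pinvKV//; last first.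
  by rewrite inE; exists z.
move=> x y; rewrite !inE => -[a Ua <-] [b Ub <-].
rewrite !chart_orbit => ab.
exact/esym/orbit_eq/orbit_wcoord.
Qed.

Lemma UV_section w : UV (wsection s s' w).
Proof.
move=> l lV; case: (label_enumP s_enum s'_enum l) => [k lk|m ->].
  by case: lV; rewrite lk; exact: enum_in s_enum k.
by rewrite (wsection_out s_enum s'_enum) oner_neq0.
Qed.

(** An explicit lift of the inverse chart, through which [f \o chi] inherits differentiability from
    [f \o orbit]. *)
Lemma chart_invE w : chi w = orbit (wsection s s' w).
Proof.
by rewrite -{1}(wsectionK s_enum s'_enum A w) chart_invK//; exact: UV_section.
Qed.

Lemma chart_invKr w : ch (chi w) = w.
Proof. by rewrite chart_invE chart_orbit (wsectionK s_enum s'_enum). Qed.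

Lemma preimage_chart_domain : orbit @^-1` dom = UV.
Proof.
apply/seteqP; split=> z /=; last by move=> Uz; exists z.
move=> [y Uy yz]; apply: UV_orbit Uy.
by rewrite yz; exact: orbit_refl.
Qed.

Lemma open_U_vertex : Defs.openC UV.
Proof.
rewrite /Defs.openC openE => x Ux.
have : nbhs x [set y : 'rV[R]_(d + d) | forall l, ~ vertex_label Fac V l -> cvec y 0 l != 0].
  apply: (@filter_forall _ 'I_d (fun l (y : 'rV[R]_(d + d)) =>
    ~ vertex_label Fac V l -> cvec y 0 l != 0) (nbhs x)) => l.
  have [lV|lV] := pselect (vertex_label Fac V l).
    by apply: filterS filterT => y _.
  (* Nonvanishing of a complex coordinate is tested on its squared modulus, a continuous real
     function. *)
  pose N y : R := complex.Re (cvec y 0 l) * complex.Re (cvec y 0 l)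
                + complex.Im (cvec y 0 l) * complex.Im (cvec y 0 l).
  have [c1 c2] := @csmooth_coord R d setT l 0%N.
  have N0 (y : 'rV[R]_(d + d)) : N y != 0 -> cvec y 0 l != 0.
    by apply: contra => /eqP; rewrite /N => ->; rewrite /= !mulr0 addr0.
  have cN : {for x, continuous N}.
    apply: differentiable_continuous.
    by apply: Cn_differentiable (CnD openT (CnM openT c1 c1) (CnM openT c2 c2)) _.
  have Nx : N x != 0 by apply: sqr_norm_neq0; exact: Ux.
  have H : nbhs x [set y | N y != 0].
    by apply: (cN [set r : R | r != 0]); apply: open_nbhs_nbhs; split=> //; exact: open_neq.
  by apply: filterS H => y /N0 yl _.
by apply: filterS => y yU l; exact: yU.
Qed.

(** A point of [UV] vanishes only at indices labeling [V], so its zero set labels a face and the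
    point lies in [U_Sigma]. *)
Lemma open_chart_domain (D : set (dual_space t)) :
  (forall S : set 'I_d, S `<=` vertex_label Fac V -> labels_face D Fac S) ->
  open_X L D Fac u dom.
Proof.
move=> faces; split; last by rewrite preimage_chart_domain; exact: open_U_vertex.
move=> _ [z Uz <-]; exists z => //; apply: faces => l /= zl.
by apply: contrapT => /Uz; rewrite zl eqxx.
Qed.

Lemma smooth_chart_coord j : smooth_X L u dom (fun y => rvec (ch y) 0 j).
Proof.
have oU := open_U_vertex.
have Cw k : csmooth (@cvec R d @^-1` UV) ((fun z => ch (orbit z) 0 k) \o @cvec R d).
  apply: (csmooth_ext oU (f := fun x => \prod_l cvec x 0 l ^ c k l)).
    by move=> x _; rewrite /= chart_orbit (wcoord_monomials s_enum s'_enum) mxE.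
  (* Exponents at the possibly vanishing coordinates [s i] are 0 or 1; negative ones occur only at
     coordinates [s' m], which do not vanish on [UV]. *)
  apply: csmooth_prod => // l; case: (label_enumP s_enum s'_enum l) => [i ->|m ->].
    rewrite (vertex_exponent_in s_enum s'_enum).
    by case: (k == i); apply: csmoothX => //; exact: csmooth_coord.
  apply: csmooth_exprz => //; last exact: csmooth_coord.
  by move=> x Ux; apply/Ux/(enumC_notin s'_enum).
rewrite /smooth_X preimage_chart_domain.
rewrite -[j]splitK; case: (fintype.split j) => k /=.
  rewrite (_ : _ \o _ = @complex.Re R \o (fun z => ch (orbit z) 0 k)).
    exact: (csmooth_smooth_on (Cw k)).1.
  by apply/funext => z; rewrite /= rvecEl.
rewrite (_ : _ \o _ = @complex.Im R \o (fun z => ch (orbit z) 0 k)).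
  exact: (csmooth_smooth_on (Cw k)).2.
by apply/funext => z; rewrite /= rvecEr.
Qed.

(** On the open set [UV] the lift of [f] factors through the monomial map, so [log_der_monomials]
    applies. Differentiability of [f \o chi] comes from the section, whose value at [w_ z] lies in
    the orbit of [z] and hence over [O]. *)
Lemma log_der_chart (O : set (set 'rV[C]_d)) (f : set 'rV[C]_d -> R) z xi l :
  smooth_X L u O f -> O (orbit z) -> UV z ->
  log_der xi l (f \o orbit) z = \sum_k (c k l)%:~R * log_der xi k (f \o chi) (w_ z).
Proof.
move=> smf Oz Uz; rewrite (wcoord_monomials s_enum s'_enum).
apply: log_der_monomials.
- have : nbhs (rvec z) (@cvec R d @^-1` UV).
    by apply: open_nbhs_nbhs; split; [exact: open_U_vertex|rewrite /= rvecK].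
  apply: filterS => x Ux.
  by rewrite -(wcoord_monomials s_enum s'_enum) /= chart_invK.
- exact: (smf [::] z Oz).
- rewrite -(wcoord_monomials s_enum s'_enum).
  rewrite (_ : _ \o _ = ((f \o orbit) \o @cvec R d) \o
      (fun y : 'rV[R]_(n + n) => rvec (wsection s s' (cvec y)))); last first.
    by apply/funext => y; rewrite /= rvecK chart_invE.
  apply: differentiable_comp; first exact: (differentiable_wsection s_enum s'_enum).
  rewrite rvecK; apply: (smf [::]).
  by rewrite /= -chart_invE chart_invK.
Qed.

Lemma quotient_bracket_chart_form (D : set (dual_space t)) (br : bracket_X R d) :
  quotient_map_is_poisson L D Fac u br -> has_chart_form L D Fac u s s' A V br.
Proof.
move=> poi O f g oO smf smg _ /[swap] -[z Uz <-] Ox.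
rewrite (poi O f g oO smf smg z Ox) chart_orbit Pi_std_log Pi_chart_log.
congr ((_ * _)%:C%C).
(* Both fields with index [l] push forward with the same coefficients [c k l]; summing over [l] then
   produces the entries of [c c^T]. *)
transitivity (\sum_l \sum_p \sum_q (c p l)%:~R * (c q l)%:~R *
    log_wedge p q (f \o chi) (g \o chi) (w_ z)).
  apply: eq_bigr => l _; rewrite /log_wedge.
  rewrite !(log_der_chart _ _ smf Ox Uz) !(log_der_chart _ _ smg Ox Uz).
  rewrite mulr_suml [X in _ - X]mulrC mulr_suml -sumrB; apply: eq_bigr => p _.
  rewrite !mulr_sumr -sumrB; apply: eq_bigr => q _; ring.
rewrite exchange_big; apply: eq_bigr => p _ /=.
rewrite exchange_big; apply: eq_bigr => q _ /=.
rewrite -mulr_suml (BV_vertex_exponent s_enum s'_enum) rmorph_sum; congr (_ * _).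
by apply: eq_bigr => l _; rewrite rmorphM.
Qed.

Lemma chart_form_homogeneous_quadratic (D : set (dual_space t)) (br : bracket_X R d) :
  (forall S : set 'I_d, S `<=` vertex_label Fac V -> labels_face D Fac S) ->
  has_chart_form L D Fac u s s' A V br -> homogeneous_quadratic L Fac u s s' A V br.
Proof.
move=> faces form j k.
pose phi j := fun w : 'rV[C]_n => rvec w 0 j.
have : quadform (fun w => 2^-1 * \sum_p \sum_q (BV A p q)%:~R *
    log_wedge p q (phi j) (phi k) w).
  apply: quadformZ; apply: quadform_sum => p; apply: quadform_sum => q.
  apply: quadformZ; apply: quadformD.
    by apply: quadformM; exact: log_der_coord.
  rewrite (_ : (fun w => - _) = (fun w => -1 * (log_der 'i%C q (phi j) w *
    log_der 1 p (phi k) w))); last by apply/funext => w; rewrite mulN1r.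
  by apply: quadformZ; apply: quadformM; exact: log_der_coord.
(* The real identity is checked in the complex numbers, where it is the chart form applied to two
   real coordinate functions on the whole chart domain. *)
move=> [Q QE]; exists Q => x xV; rewrite -QE; apply: complexI.
rewrite -Pi_chart_log.
have chiK i : (fun y => rvec (ch y) 0 i) \o chi = phi i.
  by apply/funext => w; rewrite /= chart_invKr.
rewrite -!chiK.
exact: (form _ _ _ (open_chart_domain faces) (smooth_chart_coord j)
  (smooth_chart_coord k) x xV xV).
Qed.

End VertexChart.

Theorem theorem4p7 (R : realType) (n d : nat) (t : vectType R)
    (L : set t) (D : set (dual_space t)) (Fac : 'I_d -> set (dual_space t)) (u : 'I_d -> t)
    (n_gt0 : (0 < n)%N)
    (dim_t : \dim {:t} = n)
    (L_lattice : is_lattice n L)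
    (D_delzant : is_delzant n L D)
    (Fac_enum : facet_enumeration n D Fac)
    (u_normal : forall l, primitive_inward_normal L D (Fac l) (u l))
    (br : bracket_X R d)
    (br_Pi_Sigma : is_Pi_Sigma L D Fac u br)
    (V : dual_space t)
    (V_vertex : is_vertex D V)
    (s : 'I_n -> 'I_d) (s' : 'I_(d - n) -> 'I_d)
    (s_enum : increasing_enumeration s (vertex_label Fac V))
    (s'_enum : increasing_enumeration s' (~` vertex_label Fac V))
    (A : 'M[int]_(n, d - n))
    (A_vertex : is_vertex_matrix u s s' A) :
  [/\ has_chart_form L D Fac u s s' A V br,
      (BV A)^T = BV A,
      positive_definite R (BV A) &
      homogeneous_quadratic L Fac u s s' A V br].
Proof.
have [[eta eta_dual] faces] := delzant_vertex_structure L_lattice D_delzant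
  Fac_enum u_normal V_vertex s_enum.2.
have u_lattice l : L (u l) by have [[]] := u_normal l.
have form : has_chart_form L D Fac u s s' A V br.
  exact: (quotient_bracket_chart_form u_lattice s_enum s'_enum A_vertex eta_dual)
    br_Pi_Sigma.2.
split=> //; first exact: BV_tr; first exact: BV_positive_definite.
exact: (chart_form_homogeneous_quadratic u_lattice s_enum s'_enum A_vertex eta_dual
  faces).
Qed.
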